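(* Let $r\ge 2$ and let $F$ be an $r$-critical graph. Then there exist $c_1>0$ and $n_0$ such that for all $n>n_0$ and all integers $1\le q<c_1 n$ we have $h_F(n,q)=t_F(n,q)$; in fact, more strongly, $\mathcal{H}_F(n,q)\subseteq \mathcal{T}^q_r(n)$.
   Context: A graph $F$ is $r$-critical if $\chi(F)=r+1$ and $F$ contains an edge $e$ with $\chi(F-e)=r$. $\mathrm{ex}(n,F)$ is the maximum number of edges in an $n$-vertex graph with no subgraph isomorphic to $F$. A copy of $F$ in a graph $H$ is a subgraph of $H$ isomorphic to $F$. $h_F(n,q)$ is the minimum number of copies of $F$ in a graph with $n$ vertices and $\mathrm{ex}(n,F)+q$ edges, and $\mathcal{H}_F(n,q)$ is the set of graphs with $n$ vertices and $\mathrm{ex}(n,F)+q$ edges attaining this minimum. $t_F(n,q)$ is the smallest number of copies of $F$ in a graph obtained by adding $q$ edges to a maximum $F$-free graph on $n$ vertices. $T_r(n)$ is the Turán graph (complete $r$-partite graph on $n$ vertices with parts of sizes $\lfloor n/r\rfloor$ or $\lceil n/r\rceil$), and $\mathcal{T}^q_r(n)$ is the set of graphs obtained from $T_r(n)$ by adding $q$ edges. *)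

(* Defs.v *)
From mathcomp Require Import all_boot all_order all_algebra.
Set Implicit Arguments. Unset Strict Implicit. Unset Printing Implicit Defensive.

Definition simple_graph (n : nat) (E : {set {set 'I_n}}) : bool :=
  [forall e in E, #|e| == 2].

Definition colorable (n : nat) (E : {set {set 'I_n}}) (r : nat) : Prop :=
  exists c : 'I_n -> 'I_r,
    forall e, e \in E -> forall x y, x \in e -> y \in e -> x != y -> c x != c y.

Definition chromatic_number_is (n : nat) (E : {set {set 'I_n}}) (m : nat) : Prop :=
  colorable E m /\ ~ colorable E m.-1 /\ 0 < m.

Definition r_critical (r k : nat) (EF : {set {set 'I_k}}) : Prop :=
  chromatic_number_is EF r.+1 /\
  exists2 e, e \in EF & chromatic_number_is (EF :\ e) r.

Definition copy_of (k n : nat) (EF : {set {set 'I_k}}) (f : {ffun 'I_k -> 'I_n})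
  : {set 'I_n} * {set {set 'I_n}} :=
  (f @: [set: 'I_k], [set (f @: (e : {set 'I_k})) | e in EF]).

(* Number of copies of F (subgraphs of H isomorphic to F): the distinct
   images of injective edge-preserving maps V(F) -> V(H). *)
Definition ncopies (k n : nat) (EF : {set {set 'I_k}}) (E : {set {set 'I_n}}) : nat :=
  #|[set copy_of EF f | f : {ffun 'I_k -> 'I_n}
       & injectiveb f && [forall e in EF, (f @: e) \in E]]|.

Definition Ffree (k n : nat) (EF : {set {set 'I_k}}) (E : {set {set 'I_n}}) : bool :=
  ncopies EF E == 0.

Definition ex (k : nat) (EF : {set {set 'I_k}}) (n : nat) : nat :=
  \max_(E | @simple_graph n E && Ffree EF E) #|E|.

(* minimum of g over the (finite) set P; meaningful when P is nonempty *)
Definition minover (T : finType) (P : pred T) (g : T -> nat) : nat :=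
  let top := \max_(x | P x) g x in \big[minn/top]_(x | P x) g x.

Definition hF (k : nat) (EF : {set {set 'I_k}}) (n q : nat) : nat :=
  minover (fun E : {set {set 'I_n}} => simple_graph E && (#|E| == ex EF n + q))
          (ncopies EF).

Definition in_HF (k : nat) (EF : {set {set 'I_k}}) (n q : nat)
  (E : {set {set 'I_n}}) : Prop :=
  [/\ simple_graph E, #|E| = ex EF n + q &
      forall E' : {set {set 'I_n}}, simple_graph E' -> #|E'| = ex EF n + q ->
        ncopies EF E <= ncopies EF E'].

Arguments in_HF {k} EF n q E.

Definition added_to_extremal (k : nat) (EF : {set {set 'I_k}}) (n q : nat)
  (E : {set {set 'I_n}}) : bool :=
  simple_graph E &&
  [exists M : {set {set 'I_n}},
     [&& M \subset E, simple_graph M, Ffree EF M, #|M| == ex EF n &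
         #|E :\: M| == q]].

Arguments added_to_extremal {k} EF n q E.

Definition tF (k : nat) (EF : {set {set 'I_k}}) (n q : nat) : nat :=
  minover (added_to_extremal EF n q) (ncopies EF).

(* T is a Turán graph T_r(n): complete r-partite with parts of sizes
   floor(n/r) or ceil(n/r) (equivalently, pairwise differing by at most 1). *)
Definition turan_graph (r n : nat) (T : {set {set 'I_n}}) : Prop :=
  exists p : 'I_n -> 'I_r,
    (forall i j : 'I_r, #|[set x | p x == i]| <= #|[set x | p x == j]| + 1) /\
    T = [set e : {set 'I_n} | [exists x, exists y, (p x != p y) && (e == [set x; y])]].

Arguments turan_graph : clear implicits.

Definition in_Tqr (r n q : nat) (E : {set {set 'I_n}}) : Prop :=
  simple_graph E /\
  exists T, turan_graph r n T /\ T \subset E /\ #|E :\: T| = q.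

Arguments in_Tqr : clear implicits.

(* Main.v *)
(** Let [E] minimize the number of copies of [F] among graphs with [ex(n,F) + q] edges.  Adding [q]
    edges to a Turan graph creates [O(q n^(k-2))] copies, so [E] has few copies of [F], hence, by
    blowing up, few [(r+1)]-cliques.  Stability: pass to a subset of large minimum degree, pick an
    [r]-clique with few common neighbours, and put each vertex in the part of a clique vertex it is not
    adjacent to; almost no edge lies inside a part.  In a partition with the fewest inner edges, counting
    shows that every vertex misses few cross edges, so every inner edge is the only inner edge of
    [>= alpha n^(k-2)] copies of [F]; in particular there are only [O(q)] inner edges.
    If a cross edge were missing, adding it and deleting an inner edge would destroy [>= alpha n^(k-2)]
    copies and create only [O(q n^(k-3))].  If two parts differed by more than one, moving to the smaller
    part a vertex on no inner edge and deleting inner edges would give the same contradiction.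
    The structure result with no copies at all gives [ex(n,F)] = number of edges of the Turan graph. *)
Require Import Defs.
From mathcomp Require Import all_boot all_order all_algebra.
From mathcomp Require Import perm zify ring lra.
Set Implicit Arguments. Unset Strict Implicit. Unset Printing Implicit Defensive.
Import Order.TTheory GRing.Theory Num.Theory.

(** * Counting *)

(** The exponents come from counting prescribed vertices. Since [F] is not [r]-colourable, each copy
    has an inner edge for every [r]-partition. A copy created by an exchange also uses a new cross
    edge, which has an end off some inner edge of the copy: three vertices are prescribed, leaving
    [n^(k-3)] choices per inner edge. An old inner edge prescribes only two, and the [r]-colouring
    of [F - e] lets the other [k - 2] be placed greedily. When [q < c1 n] there are at most a small
    multiple of [n] inner edges, so destruction wins.

    The obstacle is a vertex missing many cross edges, where the greedy count fails. It is overcome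
    by a bootstrap: the graph has at least as many edges as any complete [r]-partite graph, so
    missing cross arcs are no more numerous than inner arcs. A vertex missing many cross arcs can
    have only few inner arcs (in a partition with fewest inner arcs, a large inner degree already
    produces too many embeddings), and the remaining inner arcs are few because each lies in many
    embeddings of its own. Hence there is no such vertex.

    Counting is done with ordered pairs and injective maps; a copy arises from at most [k^k]
    maps. *)

Lemma card_le_fiber (T U : finType) (D : {set T}) (h : T -> U) (m : nat) :
  (forall y, #|[set x in D | h x == y]| <= m) -> #|D| <= m * #|h @: D|.
Proof.
move=> fib; rewrite -sum1_card (partition_big_imset h) /= mulnC -sum_nat_const.
apply: leq_sum => y _; apply: leq_trans (fib y).
by rewrite -sum1dep_card; apply: eq_leq; apply: eq_bigl => x; rewrite ?inE.
Qed.

Lemma card_prescribed (I V : finType) (A : {set I}) (v : I -> V) :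
  #|[set f : {ffun I -> V} | [forall i in A, f i == v i]]| = #|V| ^ #|~: A|.
Proof.
pose F i : pred V := if i \in A then pred1 (v i) else predT.
rewrite -[LHS](_ : #|family F| = _); last first.
  apply: eq_card => f; rewrite !inE; apply/familyP/forall_inP => [fF i iA|fA i].
    by have := fF i; rewrite /F iA inE.
  by rewrite /F; case: ifP => // /fA; rewrite inE.
rewrite card_family.
rewrite foldrE big_map big_enum /= (bigID (mem A)) /= big1 ?mul1n; last first.
  by move=> i iA; rewrite /F iA card1.
rewrite (eq_bigr (fun=> #|V|)); last by move=> i /negbTE iA; rewrite /F iA.
by rewrite prod_nat_const; congr (_ ^ _); apply: eq_card => i; rewrite !inE.
Qed.

Lemma card_sum_count (T U : finType) (A : {set T}) (B : {set U}) (P : T -> U -> bool) :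
  \sum_(x in A) #|[set y in B | P x y]| = \sum_(y in B) #|[set x in A | P x y]|.
Proof.
under eq_bigr do rewrite -sum1dep_card big_mkcondr /=.
rewrite exchange_big /=; apply: eq_bigr => y _.
by rewrite -sum1dep_card big_mkcondr.
Qed.

Lemma card_pairs (T U : finType) (P : T -> U -> bool) :
  #|[set z : T * U | P z.1 z.2]| = \sum_x #|[set y | P x y]|.
Proof.
under eq_bigr do rewrite -sum1dep_card.
by rewrite -sum1dep_card pair_big_dep.
Qed.

Section Rational.
Local Open Scope ring_scope.

Lemma sum_sqr_ge (I : finType) (P : pred I) (a : I -> rat) :
  (\sum_(i | P i) a i) ^+ 2 <= #|P|%:R * \sum_(i | P i) a i ^+ 2.
Proof.
rewrite expr2 mulr_suml.
have -> : #|P|%:R * \sum_(i | P i) a i ^+ 2 =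
  \sum_(i | P i) \sum_(j | P j) (a i ^+ 2 + a j ^+ 2) / 2.
  transitivity (\sum_(i | P i) \sum_(j | P j) a i ^+ 2 / 2 +
                \sum_(i | P i) \sum_(j | P j) a j ^+ 2 / 2).
    rewrite [X in _ = _ + X]exchange_big /= -big_split /= mulr_sumr.
    apply: eq_bigr => i _; rewrite sumr_const -mulr_natl; by field.
  rewrite -[LHS]big_split; apply: eq_bigr => i _; rewrite -[LHS]big_split /=.
  by apply: eq_bigr => j _; rewrite mulrDl.
apply: ler_sum => i _; rewrite mulr_sumr; apply: ler_sum => j _.
rewrite ler_pdivlMr //; have := sqr_ge0 (a i - a j); nra.
Qed.

(** Cauchy-Schwarz for the fibre sizes of [h]: they add up to [#|D|], and their squares count the
    pairs of [D] that [h] identifies. *)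
Lemma card_image_sqr (T U : finType) (D : {set T}) (h : T -> U) :
  (#|D| ^ 2 <= #|h @: D| * #|[set z : T * T | [&& z.1 \in D, z.2 \in D & h z.1 == h z.2]]|)%N.
Proof.
have -> : #|D| = (\sum_(y in h @: D) #|[set x in D | h x == y]|)%N.
  rewrite -sum1_card (partition_big_imset h) /=; apply: eq_bigr => y _.
  by rewrite -sum1dep_card; apply: eq_bigl => x.
have -> : #|[set z : T * T | [&& z.1 \in D, z.2 \in D & h z.1 == h z.2]]| =
  (\sum_(y in h @: D) #|[set x in D | h x == y]| ^ 2)%N.
  rewrite (card_pairs (fun x y => [&& x \in D, y \in D & h x == h y])).
  rewrite (bigID (mem D)) /= addnC big1 ?add0n; last first.
    by move=> x /negbTE ->; apply: eq_card0 => y; rewrite inE.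
  rewrite (partition_big_imset h) /=; apply: eq_bigr => y _.
  rewrite -mulnn -sum_nat_const [RHS](eq_bigl (fun x => (x \in D) && (h x == y))); last by move=> x; rewrite inE.
  apply: eq_bigr => x /andP[-> /eqP <-].
  by apply: eq_card => x'; rewrite !inE eq_sym.
rewrite -(ler_nat rat) natrX natrM !natr_sum.
apply: le_trans (sum_sqr_ge _ _) _.
by rewrite ler_wpM2l // ler_sum // => y _; rewrite natrX.
Qed.

End Rational.

(** * Blow-ups and greedy embeddings *)

Lemma leq_card_inj (T U : finType) (A : {set T}) (B : {set U}) (h : T -> U) :
  {in A &, injective h} -> (forall x, x \in A -> h x \in B) -> #|A| <= #|B|.
Proof.
move=> inj_h hAB; rewrite -(card_in_imset inj_h); apply: subset_leq_card.
by apply/subsetP => y /imsetP[x xA ->]; apply: hAB.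
Qed.

Section Homs.
Variables (V : finType) (g : rel V).

Definition cliques (J : finType) : {set {ffun J -> V}} :=
  [set f : {ffun J -> V} | [forall i, forall j, (i != j) ==> g (f i) (f j)]].

Section Blowup.
Variables (I J : finType) (tau : I -> J) (v0 : V).

(** Partial maps are encoded as total ones with the dummy value [v0] outside [S], so that maps on
    different index sets live in one type. Indices in one class of [tau] are unconstrained among
    themselves: they are clones of one clique vertex. *)
Definition multipartite_maps (S : {set I}) : {set {ffun I -> V}} :=
  [set f : {ffun I -> V} | [forall i, (i \notin S) ==> (f i == v0)] &&
    [forall i in S, forall j in S, (tau i != tau j) ==> g (f i) (f j)]].

Lemma multipartite_mapsP (S : {set I}) (f : {ffun I -> V}) :
  reflect ((forall i, i \notin S -> f i = v0) /\
           (forall i j, i \in S -> j \in S -> tau i != tau j -> g (f i) (f j)))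
          (f \in multipartite_maps S).
Proof.
rewrite inE; apply: (iffP andP) => [[/forallP f0 /forall_inP fg]|[f0 fg]]; split.
- by move=> i iS; apply/eqP/(implyP (f0 i)).
- by move=> i j iS jS; apply/implyP/(forall_inP (fg i iS)).
- by apply/forallP => i; apply/implyP => /f0 ->.
by apply/forall_inP => i iS; apply/forall_inP => j jS; apply/implyP; apply: fg.
Qed.

(** Two maps that agree off [i0] combine into one map on [z |: S], the clone [z] receiving the
    second value at [i0]. Cauchy-Schwarz makes such pairs numerous, since forgetting the value at
    [i0] leaves at most [#|V| ^ #|S|.-1] maps. *)
Lemma multipartite_maps_clone (S : {set I}) i0 z :
  i0 \in S -> z \notin S -> tau z = tau i0 ->
  #|multipartite_maps S| ^ 2 <= #|multipartite_maps (z |: S)| * #|V| ^ #|S|.-1.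
Proof.
move=> i0S zS tz.
pose h (f : {ffun I -> V}) := [ffun i => if i == i0 then v0 else f i].
apply: leq_trans (card_image_sqr _ h) _; rewrite mulnC; apply: leq_mul.
  pose ext (u : {ffun I -> V} * {ffun I -> V}) :=
    [ffun i => if i == z then u.2 i0 else u.1 i].
  have agree u i : h u.1 == h u.2 -> i != i0 -> u.1 i = u.2 i.
    by move=> /eqP/ffunP/(_ i); rewrite !ffunE => e /negbTE ii0; rewrite ii0 in e.
  apply: (leq_card_inj (h := ext)).
    move=> [f f'] [e e'].
    rewrite inE /= => /and3P[fS f'S hf]; rewrite inE /= => /and3P[eS e'S he] /ffunP eqx.
    have eqf : f = e.
      apply/ffunP => i; have [->|iz] := eqVneq i z.
        case/multipartite_mapsP: fS => [-> // _].
        by case/multipartite_mapsP: eS => [-> // _].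
      by have := eqx i; rewrite !ffunE (negbTE iz).
    congr pair => //; apply/ffunP => i; have [->|ii0] := eqVneq i i0.
      by have := eqx z; rewrite !ffunE eqxx.
    by rewrite -(agree (f, f')) // -(agree (e, e')) //= eqf.
  move=> [f f']; rewrite inE /= => /and3P[/multipartite_mapsP[f0 fg] /multipartite_mapsP[f0' fg'] hf].
  apply/multipartite_mapsP; split=> [i|i j].
    by rewrite !inE negb_or ffunE => /andP[/negbTE -> /f0].
  have nz i1 : i1 \in S -> (i1 == z) = false by move=> ?; apply: contraNF zS => /eqP <-.
  have neq i1 : tau i1 != tau i0 -> i1 != i0 by apply: contraNneq => ->.
  rewrite !inE !ffunE /= => /predU1P[->|iS] /predU1P[->|jS]; rewrite ?eqxx ?nz //.
  - by rewrite tz eq_sym => tj; rewrite (agree (f, f')) ?neq //; apply: fg' => //; rewrite eq_sym.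
  - by rewrite tz => ti; rewrite (agree (f, f')) ?neq //; apply: fg'.
  exact: fg.
have -> : #|S|.-1 = #|~: ~: (S :\ i0)| by rewrite setCK (cardsD1 i0 S) i0S.
rewrite -(card_prescribed _ (fun=> v0)); apply: subset_leq_card.
apply/subsetP => _ /imsetP[f /multipartite_mapsP[f0 _] ->]; rewrite inE.
apply/forall_inP => i; rewrite !inE negb_and negbK ffunE.
by case: eqP => //= _ /f0 ->.
Qed.

Section Iterate.
Local Open Scope ring_scope.

(** Each cloned index squares the density, hence the exponent [2 ^ size s]. *)
Lemma multipartite_maps_iter (s : seq I) (S : {set I}) (d : rat) :
  (0 < #|V|)%N -> (forall z, exists2 i0, i0 \in S & tau z = tau i0) ->
  uniq s -> {in s, forall z, z \notin S} -> 0 <= d ->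
  d * #|V|%:R ^+ #|S| <= #|multipartite_maps S|%:R ->
  d ^+ (2 ^ size s) * #|V|%:R ^+ (#|S| + size s) <=
    #|multipartite_maps (S :|: [set z in s])|%:R.
Proof.
move=> V0; elim: s S d => [|z s IHs] S d trS.
  move=> _ _ _; rewrite /= expn0 expr1 addn0 (_ : _ :|: _ = S) //.
  apply/setP => i; rewrite !inE. by rewrite orbF.
move=> /= /andP[zs us] sS d0 hS.
have zS : z \notin S by apply: sS; rewrite mem_head.
have [i0 i0S tz] := trS z.
have := multipartite_maps_clone i0S zS tz.
have S0 : (0 < #|S|)%N by apply/card_gt0P; exists i0.
set m := #|S|.-1; have Sm : #|S| = m.+1 by rewrite prednK.
move=> hz; have {hz}hz : d ^+ 2 * #|V|%:R ^+ #|z |: S| <= #|multipartite_maps (z |: S)|%:R.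
  have Vm : 0 < #|V|%:R ^+ m :> rat by rewrite exprn_gt0 // ltr0n.
  rewrite -(ler_pM2r Vm) cardsU1 zS Sm.
  apply: (@le_trans _ _ (#|multipartite_maps S|%:R ^+ 2)); last first.
    by rewrite -!natrX -natrM ler_nat.
  have -> : d ^+ 2 * #|V|%:R ^+ (true + m.+1) * #|V|%:R ^+ m = (d * #|V|%:R ^+ #|S|) ^+ 2.
    by rewrite Sm exprMn -mulrA -exprD -[(_ ^+ m.+1) ^+ 2]exprM; congr (_ * _ ^+ _); lia.
  by rewrite lerXn2r // ?nnegrE ?mulr_ge0 // ?exprn_ge0.
have := IHs (z |: S) (d ^+ 2) _ us _ (sqr_ge0 d) hz.
rewrite -exprM -expnS cardsU1 zS add1n addSnnS /=.
rewrite (_ : (z |: S) :|: [set i in s] = S :|: [set i in z :: s]); last first.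
  by apply/setP => i; rewrite !inE -orbA orbCA.
apply.
  by move=> y; have [i i_S ->] := trS y; exists i => //; rewrite inE i_S orbT.
move=> y ys; rewrite !inE negb_or sS ?inE ?ys ?orbT // andbT.
by apply: contraNneq zs => <-.
Qed.

(** [sigma] picks a representative in each class of [tau]. Cliques give maps on the representatives,
    and the other indices are cloned one by one. *)
Lemma blowup_count (sigma : J -> I) (d : rat) :
  cancel sigma tau -> (0 < #|V|)%N -> 0 <= d ->
  d * #|V|%:R ^+ #|J| <= #|cliques J|%:R ->
  d ^+ (2 ^ (#|I| - #|J|)) * #|V|%:R ^+ #|I| <=
    #|[set f : {ffun I -> V} | [forall i, forall j, (tau i != tau j) ==> g (f i) (f j)]]|%:R.
Proof.
move=> sK V0 d0 hd.
pose S := [set sigma j | j : J].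
have cS : #|S| = #|J| by rewrite card_imset //; apply: can_inj sK.
have memS i : (i \in S) = (sigma (tau i) == i).
  by apply/imsetP/eqP => [[j _ ->]|<-]; [rewrite sK | exists (tau i)].
have hS : d * #|V|%:R ^+ #|S| <= #|multipartite_maps S|%:R.
  rewrite cS; apply: le_trans hd _; rewrite ler_nat.
  apply: (leq_card_inj (h := fun f : {ffun J -> V} => [ffun i => if i \in S then f (tau i) else v0])).
    move=> f f' _ _ /ffunP eqf; apply/ffunP => j.
    by have := eqf (sigma j); rewrite !ffunE memS sK eqxx.
  move=> f; rewrite inE => /forallP fg; apply/multipartite_mapsP; split=> [i|i j].
    by rewrite ffunE => /negbTE ->.
  by move=> iS jS tij; rewrite !ffunE iS jS; apply: (implyP (forallP (fg _) _)).
have := @multipartite_maps_iter (enum (~: S)) S d V0 _ (enum_uniq _) _ d0 hS.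
rewrite -cardE cardsC cardsCs setCK cS => H.
apply: le_trans (H _ _) _.
- by move=> z; exists (sigma (tau z)); rewrite ?memS ?sK.
- by move=> z; rewrite mem_enum inE.
rewrite ler_nat; apply: subset_leq_card; apply/subsetP => f /multipartite_mapsP[_ fg].
rewrite inE; apply/forallP => i; apply/forallP => j; apply/implyP; apply: fg;
by rewrite !inE mem_enum !inE orbN.
Qed.

End Iterate.
End Blowup.
End Homs.

Section Greedy.
Local Open Scope ring_scope.

Lemma leq_card_all (T : eqType) (W : finType) (C : {set W}) (P : T -> pred W) (s : seq T) :
  (#|C| <= #|[set w in C | all (P^~ w) s]| + \sum_(i <- s) #|[set w in C | ~~ P i w]|)%N.
Proof.
elim: s => [|i s IHs]; first by rewrite big_nil addn0 (eq_leq (eq_card _)) // => w; rewrite !inE andbT.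
rewrite big_cons addnA; apply: leq_trans IHs _; rewrite leq_add2r.
rewrite -(cardsID [set w | P i w] [set w in C | all (P^~ w) s]); apply: leq_add.
  by apply: subset_leq_card; apply/subsetP => w; rewrite !inE /= => /andP[/andP[-> ->] ->].
by apply: subset_leq_card; apply/subsetP => w; rewrite !inE => /andP[-> /andP[->]].
Qed.

(** Outside [s] the maps are frozen at [f0]: this lets the count run by induction on [s], and it
    records vertices embedded beforehand. *)
Definition greedy_maps (V I : finType) (C : I -> {set V}) (ok : I -> I -> rel V)
    (f0 : I -> V) (s : seq I) : {set {ffun I -> V}} :=
  [set f : {ffun I -> V} | [forall i, if i \in s then f i \in C i else f i == f0 i] &&
    [forall i, forall j, [&& i \in s, j \in s & i != j] ==> ok i j (f i) (f j)]].

Lemma greedy_mapsP (V I : finType) (C : I -> {set V}) (ok : I -> I -> rel V)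
    (f0 : I -> V) (s : seq I) (f : {ffun I -> V}) :
  reflect [/\ forall i, i \in s -> f i \in C i, forall i, i \notin s -> f i = f0 i &
      forall i j, i \in s -> j \in s -> i != j -> ok i j (f i) (f j)]
    (f \in greedy_maps C ok f0 s).
Proof.
rewrite inE; apply: (iffP andP) => [[/forallP fC /forallP fok]|[fC f_0 fok]]; split.
- by move=> i si; have := fC i; rewrite si.
- by move=> i /negbTE si; have := fC i; rewrite si => /eqP.
- by move=> i j si sj ij; apply: (implyP (forallP (fok i) j)); rewrite si sj.
- by apply/forallP => i; case: ifPn => [/fC//|/f_0 ->].
by apply/forallP => i; apply/forallP => j; apply/implyP => /and3P[]; apply: fok.
Qed.

(** Each vertex already placed spoils at most [N] candidates of the next one, and at most
    [(size s).-1] are placed before it, so at least [L] candidates survive every time. *)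
Lemma greedy_count (V I : finType) (C : I -> {set V}) (ok : I -> I -> rel V)
    (f0 : I -> V) (L N : rat) (s : seq I) :
  (forall i j w w', ok i j w w' = ok j i w' w) ->
  uniq s -> 0 <= L -> 0 <= N ->
  {in s, forall i, L + (size s).-1%:R * N <= #|C i|%:R} ->
  {in s &, forall i j, i != j -> {in C i, forall w,
    #|[set w' in C j | ~~ ok i j w w']|%:R <= N}} ->
  L ^+ size s <= #|greedy_maps C ok f0 s|%:R.
Proof.
move=> ok_sym + L0 N0; elim: s => [|z s IHs].
  move=> _ _ _; rewrite expr0 ler1n; apply/card_gt0P; exists [ffun i => f0 i].
  by apply/greedy_mapsP; split=> // i; rewrite ffunE.
move=> /= /andP[zs us] hC hN.
have {IHs}IHs : L ^+ size s <= #|greedy_maps C ok f0 s|%:R.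
  apply: IHs => // [i si|i j si sj]; last by apply: hN; rewrite inE ?si ?sj orbT.
  apply: le_trans (hC i _); last by rewrite inE si orbT.
  by rewrite lerD2l ler_wpM2r // ler_nat leq_pred.
pose G f := [set w in C z | all (fun i => ok i z (f i) w) s].
have GL (f : {ffun I -> V}) : f \in greedy_maps C ok f0 s -> L <= #|G f|%:R.
  case/greedy_mapsP => fC _ _.
  have := leq_card_all (C z) (fun i w => ok i z (f i) w) s.
  rewrite -(ler_nat rat) natrD natr_sum => le1.
  have le2 : \sum_(i <- s) (#|[set w in C z | ~~ ok i z (f i) w]|%:R : rat) <= (size s)%:R * N.
    have -> : (size s)%:R * N = \sum_(i <- s) N.
      by rewrite big_const_seq count_predT iter_addr_0 mulr_natl.
    rewrite big_seq [X in _ <= X]big_seq.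
    apply: ler_sum => i si; apply: hN; rewrite ?inE ?eqxx ?si ?orbT //; last exact: fC.
    by apply: contraNneq zs => <-.
  have := hC z (mem_head _ _); rewrite /G; lra.
rewrite exprSr; apply: (@le_trans _ _ (#|greedy_maps C ok f0 s|%:R * L)).
  by rewrite ler_wpM2r.
apply: (@le_trans _ _ (\sum_(f in greedy_maps C ok f0 s) #|G f|)%N%:R).
  by rewrite natr_sum mulr_natl -sumr_const ler_sum.
rewrite ler_nat.
have -> : (\sum_(f in greedy_maps C ok f0 s) #|G f| =
   #|[set u : {ffun I -> V} * V | (u.1 \in greedy_maps C ok f0 s) && (u.2 \in G u.1)]|)%N.
  rewrite (card_pairs (fun f w => (f \in greedy_maps C ok f0 s) && (w \in G f))) big_mkcond /=.
  apply: eq_bigr => f _; case: ifP => fg; last by apply/esym/eq_card0 => w; rewrite inE.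
  by apply: eq_card => w; rewrite [in RHS]inE.
apply: (leq_card_inj (h := fun u : {ffun I -> V} * V => [ffun i => if i == z then u.2 else u.1 i])).
  move=> [f w] [f' w']; rewrite inE [in X in _ -> X -> _]inE /=.
  move=> /andP[/greedy_mapsP[_ fz _] _] /andP[/greedy_mapsP[_ fz' _] _] /ffunP eqf.
  have := eqf z; rewrite !ffunE eqxx => <-; congr pair; apply/ffunP => i.
  have [->|iz] := eqVneq i z; first by rewrite fz ?fz'.
  by have := eqf i; rewrite !ffunE (negbTE iz).
move=> [f w]; rewrite inE /= => /andP[/greedy_mapsP[fC fz fok]]; rewrite inE => /andP[wC /allP wok].
have nz i : i \in s -> (i == z) = false by move=> si; apply: contraNF zs => /eqP <-.
apply/greedy_mapsP; split=> [i|i|i j]; rewrite ?inE ?ffunE.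
- by case: eqP => [->|_] //= /fC.
- by rewrite negb_or => /andP[/negbTE -> /fz].
case: (eqVneq i z) => [->|iz]; case: (eqVneq j z) => [->|jz] //=.
- by move=> _ sj _; rewrite ok_sym; apply: wok.
- by move=> si _ _; apply: wok.
exact: fok.
Qed.

End Greedy.

(** * Stability *)

Local Open Scope ring_scope.

Lemma nat_above (x : rat) : exists n0 : nat, forall n : nat, (n0 < n)%N -> x <= n%:R.
Proof.
exists (Num.bound `|x|) => n hn; apply: le_trans (ler_norm x) _.
by apply: ltW; apply: lt_trans (archi_boundP (normr_ge0 x)) _; rewrite ltr_nat.
Qed.

Lemma exists_le_mean (T : finType) (A : {set T}) (F : T -> nat) :
  (0 < #|A|)%N -> exists2 x, x \in A & (F x * #|A| <= \sum_(y in A) F y)%N.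
Proof.
case/card_gt0P => x0 x0A; case: (arg_minnP F x0A) => x xA xmin.
by exists x => //; rewrite mulnC -sum_nat_const; apply: leq_sum => y /xmin.
Qed.

Section Arcs.
Variables (V : finType) (g : rel V).

Definition deg_in (S : {set V}) (x : V) : nat := #|[set y in S | g x y]|.
(** Ordered pairs are counted: an edge contributes twice here and in [inner_arcs]. *)
Definition arcs_in (S : {set V}) : nat := (\sum_(x in S) deg_in S x)%N.
Definition inner_arcs (r : nat) (p : V -> 'I_r) (S : {set V}) : nat :=
  (\sum_(x in S) #|[set y in S | g x y && (p x == p y)]|)%N.

Lemma sum_same_part (r : nat) (p : V -> 'I_r) (S : {set V}) :
  (\sum_(x in S) #|[set y in S | p x == p y]| =
   \sum_(i < r) #|[set y in S | p y == i]| ^ 2)%N.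
Proof.
rewrite (partition_big p predT) //=; apply: eq_bigr => i _.
rewrite -mulnn -sum_nat_const [RHS](eq_bigl (fun x => (x \in S) && (p x == i))); last by move=> x; rewrite inE.
by apply: eq_bigr => x /andP[_ /eqP <-]; apply: eq_card => y; rewrite !inE eq_sym.
Qed.

Lemma sum_parts (r : nat) (p : V -> 'I_r) (S : {set V}) :
  (\sum_(i < r) #|[set y in S | p y == i]| = #|S|)%N.
Proof.
rewrite -[RHS]sum1_card (partition_big p predT) //=; apply: eq_bigr => i _.
by rewrite -sum1dep_card.
Qed.

Lemma sum_sqr_parts_ge (r : nat) (p : V -> 'I_r) (S : {set V}) :
  #|S|%:R ^+ 2 <= r%:R * (\sum_(i < r) #|[set y in S | p y == i]| ^ 2)%N%:R :> rat.
Proof.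
have := sum_sqr_ge predT (fun i : 'I_r => #|[set y in S | p y == i]|%:R : rat).
rewrite card_ord -natr_sum sum_parts => /le_trans; apply.
by rewrite natr_sum; apply: ler_wpM2l => //; apply: ler_sum => i _; rewrite natrX.
Qed.

(** The pairs in different parts number [#|S|^2] minus the sum of the squared part sizes, which is
    at least [#|S|^2 / r] by Cauchy-Schwarz. *)
Lemma arcs_in_le_inner (r : nat) (p : V -> 'I_r) (S : {set V}) : (0 < r)%N ->
  (arcs_in S)%:R <= (inner_arcs p S)%:R + (1 - r%:R^-1) * #|S|%:R ^+ 2 :> rat.
Proof.
move=> r0; have rr : 0 < r%:R :> rat by rewrite ltr0n.
have le1 : (arcs_in S + \sum_(x in S) #|[set y in S | p x == p y]| <= inner_arcs p S + #|S| * #|S|)%N.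
  rewrite -sum_nat_const /arcs_in /inner_arcs -!big_split /=; apply: leq_sum => x _.
  rewrite -(cardsUI [set y in S | g x y]) addnC; apply: leq_add; apply: subset_leq_card.
    by apply/subsetP => y; rewrite !inE => /andP[/andP[-> ->] ->].
  by apply/subsetP => y; rewrite !inE => /orP[] /andP[].
move: le1; rewrite sum_same_part -(ler_nat rat) !natrD natrM.
have := sum_sqr_parts_ge p S; rewrite mulrC -ler_pdivrMr // mulrC.
lra.
Qed.

Lemma inner_arcs_pairs (r : nat) (p : V -> 'I_r) (S : {set V}) :
  inner_arcs p S = #|[set z : V * V | [&& z.1 \in S, z.2 \in S, g z.1 z.2 & p z.1 == p z.2]]|.
Proof.
rewrite (card_pairs (fun x y => [&& x \in S, y \in S, g x y & p x == p y])).
rewrite /inner_arcs big_mkcond; apply: eq_bigr => x _; case: ifP => xS.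
  by apply: eq_card => y; rewrite !inE.
by apply/esym/eq_card0 => y; rewrite inE.
Qed.

(** A clique together with a common neighbour is a clique on [option I], the new vertex sitting at
    [None]. *)
Lemma clique_extensions (I : finType) (T : {set {ffun I -> V}}) :
  symmetric g -> T \subset cliques g I ->
  (\sum_(f in T) #|[set w | [forall i, g (f i) w]]| <= #|cliques g (option I)|)%N.
Proof.
move=> gs /subsetP TI.
have -> : (\sum_(f in T) #|[set w | [forall i, g (f i) w]]| =
   #|[set u : {ffun I -> V} * V | (u.1 \in T) && [forall i, g (u.1 i) u.2]]|)%N.
  rewrite (card_pairs (fun (f : {ffun I -> V}) w => (f \in T) && [forall i, g (f i) w])) big_mkcond /=.
  apply: eq_bigr => f _; case: ifP => fg; last by apply/esym/eq_card0 => w; rewrite inE.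
  by apply: eq_card => w; rewrite !inE.
apply: (leq_card_inj (h := fun u : {ffun I -> V} * V => [ffun o => if o is Some i then u.1 i else u.2])).
  move=> [f w] [f' w'] _ _ /ffunP eqf; congr pair.
    by apply/ffunP => i; have := eqf (Some i); rewrite !ffunE.
  by have := eqf None; rewrite !ffunE.
move=> [f w]; rewrite inE /= => /andP[/TI]; rewrite inE => /forallP fg /forallP fw.
rewrite inE; apply/forallP => o; apply/forallP => o'; apply/implyP.
case: o o' => [i|] [j|] //= ij; rewrite !ffunE //.
  by apply: (implyP (forallP (fg i) j)).
by rewrite gs.
Qed.

(** Replacing [f i] by [z.1] and putting [z.2] at [None] gives a clique with one more vertex; the
    factor [#|V|] remembers the lost vertex [f i]. *)
Lemma clique_replacements (I : finType) (T : {set {ffun I -> V}}) (i : I) :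
  symmetric g -> T \subset cliques g I ->
  (\sum_(f in T) #|[set z : V * V | g z.1 z.2 &&
      [forall j, (j != i) ==> g (f j) z.1 && g (f j) z.2]]| <= #|cliques g (option I)| * #|V|)%N.
Proof.
move=> gs /subsetP TI.
pose P (f : {ffun I -> V}) (z : V * V) := g z.1 z.2 &&
      [forall j, (j != i) ==> g (f j) z.1 && g (f j) z.2].
have -> : (\sum_(f in T) #|[set z | P f z]| =
   #|[set u : {ffun I -> V} * (V * V) | (u.1 \in T) && P u.1 u.2]|)%N.
  rewrite (card_pairs (fun (f : {ffun I -> V}) w => (f \in T) && P f w)) big_mkcond /=.
  apply: eq_bigr => f _; case: ifP => fg; last by apply/esym/eq_card0 => w; rewrite inE.
  by apply: eq_card => w; rewrite !inE.
rewrite -cardsT -cardsX.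
pose h (u : {ffun I -> V} * (V * V)) :=
  ([ffun o => if o is Some j then (if j == i then u.2.1 else u.1 j) else u.2.2], u.1 i).
apply: (leq_card_inj (h := h)).
  move=> [f [w1 w2]] [f' [w1' w2']] _ _ [/ffunP eqf eqi].
  congr (_, (_, _)).
  - apply/ffunP => j; have := eqf (Some j); rewrite !ffunE /=.
    by case: eqP => [->|].
  - by have := eqf (Some i); rewrite !ffunE /= eqxx.
  - by have := eqf None; rewrite !ffunE.
move=> [f [w1 w2]]; rewrite inE /= => /andP[/TI]; rewrite inE => /forallP fg.
case/andP=> /= gw /forallP fw; rewrite !inE andbT.
have fw' j : j != i -> g (f j) w1 /\ g (f j) w2 by move=> ji; apply/andP/(implyP (fw j)).
apply/forallP => o; apply/forallP => o'; apply/implyP.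
case: o o' => [j|] [j'|] //= jj; rewrite !ffunE //.
- have jj' : j != j' by apply: contraNneq jj => ->.
  case: (eqVneq j i) => ji; case: (eqVneq j' i) => ji' //.
  + by rewrite ji ji' eqxx in jj'.
  + by rewrite gs; case: (fw' _ ji').
  + by case: (fw' _ ji).
  by apply: (implyP (forallP (fg j) j')).
- by case: (eqVneq j i) => ji //; case: (fw' _ ji).
by case: (eqVneq j' i) => ji; rewrite gs //; case: (fw' _ ji).
Qed.

End Arcs.

Section CliquePartition.
Variables (V : finType) (g : rel V) (r : nat) (S : {set V}) (f : {ffun 'I_r -> V}).
Hypothesis r0 : (0 < r)%N.
Let W := [set w | [forall i, g (f i) w]].
Let J := [set w in S | 1 < #|[set i | ~~ g (f i) w]|]%N.

(** The last case is a default for common neighbours of the clique ([W]). A vertex with several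
    non-neighbours in the clique gets one of them; those in [S] form [J] and are treated as
    exceptional. *)
Definition clique_partition (w : V) : 'I_r :=
  if [pick i | ~~ g (f i) w] is Some i then i else Ordinal r0.

Lemma clique_partition_adj w : w \in S -> w \notin W -> w \notin J ->
  forall j, j != clique_partition w -> g (f j) w.
Proof.
move=> wS; rewrite !inE wS /= -leqNgt /clique_partition.
case: pickP => [i iw _ le1 j ji|none /negP[]]; last first.
  by apply/forallP => i; have := none i => /negbT; rewrite negbK.
apply: contraTT le1 => jw; rewrite -ltnNge (cardsD1 i) inE iw.
rewrite (cardsD1 j) !inE ji jw; lia.
Qed.

(** A vertex of [S] outside [J] and [W] is adjacent to every clique vertex except that of its part,
    so an inner arc between two such vertices can replace that clique vertex. Arcs meeting [J] or
    [W] are bounded trivially. *)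
Lemma inner_arcs_clique_partition :
  (inner_arcs g clique_partition S <=
    \sum_(i < r) #|[set z : V * V | g z.1 z.2 &&
      [forall j, (j != i) ==> g (f j) z.1 && g (f j) z.2]]| + 2 * ((#|J| + #|W|) * #|V|))%N.
Proof.
rewrite inner_arcs_pairs.
set B := [set z | _].
pose F i := [set z : V * V | g z.1 z.2 && [forall j, (j != i) ==> g (f j) z.1 && g (f j) z.2]].
have sub : B \subset (\bigcup_(i < r) F i) :|: (setX (J :|: W) setT :|: setX setT (J :|: W)).
  apply/subsetP => -[w w']; rewrite !inE /= => /and4P[wS w'S gw pw].
  have [wJ|/norP[wJ wW]] := boolP ((w \in J) || (w \in W)).
    by move: wJ; rewrite !inE => ->; rewrite ?orbT.
  have [wJ'|/norP[wJ' wW']] := boolP ((w' \in J) || (w' \in W)).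
    by move: wJ'; rewrite !inE => ->; rewrite ?orbT.
  apply/orP; left; apply/bigcupP; exists (clique_partition w) => //; rewrite inE /= gw.
  apply/forallP => j; apply/implyP => jp; rewrite !clique_partition_adj //.
  by rewrite -(eqP pw).
apply: leq_trans (subset_leq_card sub) _.
apply: leq_trans (leq_card_setU _ _) _; apply: leq_add.
  elim/big_rec2: _ => [|i m A _ IH]; first by rewrite cards0.
  by apply: leq_trans (leq_card_setU _ _) _; rewrite leq_add2l.
apply: leq_trans (leq_card_setU _ _) _.
rewrite !cardsX !cardsT [(#|V| * _)%N]mulnC addnn -mul2n leq_mul2l /= leq_mul2r.
by rewrite leq_card_setU orbT.
Qed.

(** Double counting of non-adjacencies: a vertex of [S] has at least one outside [W] and at least
    two in [J]. Under a minimum degree condition the sum is close to [#|S|], so [J] is small as soon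
    as [W] is. *)
Lemma card_multi_nonadjacent :
  (#|S| + #|J| <= \sum_(i < r) #|[set w in S | ~~ g (f i) w]| + #|W|)%N.
Proof.
have -> : (\sum_(i < r) #|[set w in S | ~~ g (f i) w]| = \sum_(w in S) #|[set i | ~~ g (f i) w]|)%N.
  transitivity (\sum_(i in [set: 'I_r]) #|[set w in S | ~~ g (f i) w]|)%N.
    by apply: eq_bigl => i; rewrite inE.
  rewrite (card_sum_count _ S (fun i w => ~~ g (f i) w)).
  by apply: eq_bigr => w _; apply: eq_card => i; rewrite !inE.
have -> : #|S| = (\sum_(w in S) 1)%N by rewrite sum1_card.
have -> : #|J| = (\sum_(w in S) (1 < #|[set i | ~~ g (f i) w]|))%N.
  by rewrite -sum1dep_card -big_mkcondr /=; apply: eq_bigl.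
have le : (\sum_(w in S) (w \in W) <= #|W|)%N.
  rewrite -big_mkcondr /= sum1dep_card; apply: subset_leq_card.
  by apply/subsetP => w; rewrite inE => /andP[].
apply: leq_trans (leq_add (leqnn _) le); rewrite -!big_split /=; apply: leq_sum => w _.
have [wW|wW] := boolP (w \in W); first by case: (#|_|) => [|[]].
suff : (0 < #|[set i | ~~ g (f i) w]|)%N by case: (#|_|) => [|[]].
move: wW; rewrite inE negb_forall => /existsP[i iw]; apply/card_gt0P; exists i.
by rewrite inE.
Qed.

End CliquePartition.

Lemma cliques_min_degree (V : finType) (g : rel V) (r : nat) (S : {set V}) (N : rat) :
  symmetric g -> S != set0 -> 0 <= N ->
  {in S, forall w, #|[set w' in S | ~~ g w w']|%:R <= N} ->
  r.-1%:R * N <= #|S|%:R ->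
  exists2 T : {set {ffun 'I_r -> V}}, (#|S|%:R - r.-1%:R * N) ^+ r <= #|T|%:R &
    T \subset cliques g 'I_r /\ forall f, f \in T -> forall i, f i \in S.
Proof.
move=> gs /set0Pn[x0 _] N0 hN hS.
exists (greedy_maps (fun=> S) (fun _ _ => g) (fun=> x0) (enum 'I_r)).
  rewrite -[in X in _ ^+ X](size_enum_ord r); apply: (@greedy_count V _ (fun=> S) (fun _ _ => g) _ _ N) => //.
  - by rewrite enum_uniq.
  - by rewrite subr_ge0.
  by move=> i _; rewrite size_enum_ord subrK.
split=> [|f /greedy_mapsP[fS _ _] i]; last by apply: fS; rewrite mem_enum.
apply/subsetP => f /greedy_mapsP[_ _ fg]; rewrite inE.
by apply/forallP => i; apply/forallP => j; apply/implyP; apply: fg; rewrite mem_enum.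
Qed.

(** Averaging over the [r]-cliques in [S] yields one that has both few common neighbours and few
    replacing arcs; its [clique_partition] is taken. The bound [4 r^2 eps <= 1] keeps the greedy
    number of cliques large. *)
Lemma min_degree_partition (r : nat) (eps eps1 : rat) :
  (0 < r)%N -> 0 < eps -> 4 * r%:R ^+ 2 * eps <= 1 -> 0 < eps1 ->
  exists eps0 : rat, 0 < eps0 /\ exists n0 : nat,
  forall (V : finType) (g : rel V) (S : {set V}),
  symmetric g -> (n0 < #|V|)%N ->
  #|cliques g (option 'I_r)|%:R <= eps0 * #|V|%:R ^+ r.+1 ->
  eps * #|V|%:R <= #|S|%:R ->
  (forall x, x \in S -> (1 - r%:R^-1 - eps) * #|S|%:R - 1 <= (deg_in g S x)%:R) ->
  exists p : V -> 'I_r,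
    (inner_arcs g p S)%:R <= (2 * r%:R * eps + 5 * eps1) * #|V|%:R ^+ 2.
Proof.
move=> r0 e0 er e10.
pose R : rat := r%:R.
have R1 : 1 <= R by rewrite ler1n.
have R4 : 0 < 4 * R by lra.
have R4i : 0 < (4 * R)^-1 by rewrite invr_gt0.
have er0 : 0 < eps / (4 * R) by rewrite divr_gt0 //; lra.
(* Chosen so that [r + 1] sums, each at most the number of larger cliques times [n], average to at
   most [eps1 n^2] over at least [(eps n / (4 R)) ^ r] cliques. *)
exists (eps1 * (eps / (4 * R)) ^+ r / (R + 1)); split.
  by rewrite divr_gt0 ?mulr_gt0 ?exprn_gt0 //; lra.
have [n1 hn1] := nat_above (4 * R ^+ 2 / eps); have [n2 hn2] := nat_above (2 * R / eps1).
exists (maxn n1 n2) => V g S gs; rewrite gtn_max => /andP[/hn1 nn1 /hn2 nn2] hcl hSn hdeg.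
set n : rat := #|V|%:R in nn1 nn2 hcl hSn *; set s : rat := #|S|%:R in hSn hdeg *.
have n_ge0 : 0 <= n by rewrite ler0n.
have nn1' : 4 * R ^+ 2 <= n * eps by rewrite -ler_pdivrMr.
have nn2' : 2 * R <= n * eps1 by rewrite -ler_pdivrMr.
have s_big : 4 * R ^+ 2 <= s by apply: le_trans hSn; rewrite [eps * n]mulrC.
have sn : s <= n by rewrite ler_nat max_card.
have n0 : 0 < n by nra.
have s_ge0 : 0 <= s by rewrite ler0n.
pose N := (R^-1 + eps) * s + 1.
have Rinv : R * R^-1 = 1 by rewrite divff // lt0r_neq0 //; lra.
have Rinv0 : 0 < R^-1 by rewrite invr_gt0; lra.
have hN : {in S, forall w, #|[set w' in S | ~~ g w w']|%:R <= N}.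
  move=> w /hdeg; rewrite /deg_in.
  have : (#|[set w' in S | g w w']| + #|[set w' in S | ~~ g w w']|)%N%:R = s.
    congr (_%:R); rewrite -(cardsID [set w' | g w w'] S).
    by congr addn; apply: eq_card => w'; rewrite !inE // andbC.
  rewrite natrD /N -/R; lra.
have N0 : 0 <= N by rewrite /N; nra.
have r1 : r.-1%:R = R - 1 by rewrite -subn1 natrB.
have hL : s / (4 * R) <= s - r.-1%:R * N.
  rewrite r1 /N invfM; set u := R^-1 in Rinv Rinv0 *.
  have Re : 0 <= R * eps by rewrite mulr_ge0; lra.
  have e1 : 4 * R * (R - 1) * eps * s <= s.
    by rewrite -[X in _ <= X]mul1r ler_wpM2r //; move: er; rewrite -/R expr2; lra.
  have e2 : 4 * R * (R - 1) <= s by nra.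
  rewrite -(@ler_pM2l _ (4 * R)); last by lra.
  have -> : 4 * R * (s * (4^-1 * u)) = (R * u) * s by field.
  have -> : 4 * R * (s - (R - 1) * ((u + eps) * s + 1)) =
     4 * R * s - 4 * (R * u) * (R - 1) * s - 4 * R * (R - 1) * eps * s - 4 * R * (R - 1) by ring.
  rewrite Rinv; lra.
have sR : 0 < s / (4 * R).
  by apply: divr_gt0 R4; apply: lt_le_trans s_big; apply: mulr_gt0 => //; apply: exprn_gt0; lra.
have S0 : S != set0.
  by apply/negP => /eqP S0; move: s_big; rewrite /s S0 cards0; nra.
have [|T hT [Tcl TS]] := @cliques_min_degree V g r S N gs S0 N0 hN; first by rewrite -/s; lra.
have hT' : (s / (4 * R)) ^+ r <= #|T|%:R.
  by apply: le_trans hT; rewrite lerXn2r // nnegrE; lra.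
have T0 : (0 < #|T|)%N by rewrite -(ltr_nat rat); apply: lt_le_trans hT'; rewrite exprn_gt0.
pose w_ (f : {ffun 'I_r -> V}) := #|[set w | [forall i, g (f i) w]]|.
pose i_ (f : {ffun 'I_r -> V}) := (\sum_(i < r) #|[set z : V * V | g z.1 z.2 &&
      [forall j, (j != i) ==> g (f j) z.1 && g (f j) z.2]]|)%N.
(* The weight [#|V|] on [w_ f] brings both quantities to the scale [n^2], so one average controls
   them together. *)
have sumle : (\sum_(f in T) (#|V| * w_ f + i_ f) <= r.+1 * (#|cliques g (option 'I_r)| * #|V|))%N.
  rewrite big_split /= -big_distrr /= mulSn; apply: leq_add.
    by rewrite mulnC leq_mul2r; apply/orP; right; apply: clique_extensions.
  rewrite exchange_big /= -[X in (_ <= X * _)%N](card_ord r) -sum_nat_const.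
  by apply: leq_sum => i _; apply: clique_replacements.
have [f fT fle] := exists_le_mean (fun f => (#|V| * w_ f + i_ f)%N) T0.
have {fle sumle}fle : n * (w_ f)%:R + (i_ f)%:R <= eps1 * n ^+ 2.
  have le1 := leq_trans fle sumle; move: le1; rewrite -(ler_nat rat) !natrM natrD natrM -/n => le1.
  have Tn : (eps * n / (4 * R)) ^+ r <= #|T|%:R.
    apply: le_trans hT'; apply: lerXn2r; rewrite ?nnegrE; last by rewrite (ler_pM2r R4i).
      by apply: divr_ge0; [apply: mulr_ge0; [exact: ltW | exact: n_ge0] | exact: ltW].
    exact: ltW.
  have En : 0 < (eps * n / (4 * R)) ^+ r.
    by apply: exprn_gt0; apply: divr_gt0; [exact: mulr_gt0 | exact: R4].
  rewrite -(ler_pM2r En).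
  apply: (@le_trans _ _ ((n * (w_ f)%:R + (i_ f)%:R) * #|T|%:R)).
    by rewrite ler_wpM2l // addr_ge0 ?mulr_ge0.
  apply: le_trans le1 _.
  have -> : eps1 * n ^+ 2 * (eps * n / (4 * R)) ^+ r =
    (R + 1) * (eps1 * (eps / (4 * R)) ^+ r / (R + 1) * n ^+ r.+1 * n).
    rewrite (_ : eps * n / (4 * R) = eps / (4 * R) * n); last by rewrite mulrAC.
    rewrite exprMn [n ^+ r.+1]exprS; set u := (_ ^+ r); set v := (n ^+ r); field.
    by rewrite lt0r_neq0 //; lra.
  rewrite -natr1 -/R; apply: ler_wpM2l; first lra.
  by apply: ler_wpM2r.
exists (clique_partition g f r0).
have := inner_arcs_clique_partition g S f r0; have := card_multi_nonadjacent g S f.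
rewrite -/(w_ f) -/(i_ f); set j := #|[set w in S | (1 < _)%N]|; rewrite -!(ler_nat rat) !natrD !natrM natrD -/s -/n natr_sum => le1 le2.
have le3 : \sum_(i < r) (#|[set w in S | ~~ g (f i) w]|%:R : rat) <= R * N.
  rewrite /R -[r in r%:R]card_ord mulr_natl -sumr_const; apply: ler_sum => i _.
  by apply: hN; apply: TS.
have RN : R * N = s + R * eps * s + R.
  by rewrite /N; transitivity ((R * R^-1) * s + R * eps * s + R); [ring | rewrite Rinv; ring].
have jle : j%:R <= R * eps * n + R + (w_ f)%:R.
  have : R * eps * s <= R * eps * n by rewrite ler_wpM2l //; nra.
  lra.
have i0 : 0 <= (i_ f)%:R :> rat by [].
have jn : j%:R * n <= (R * eps * n + R + (w_ f)%:R) * n by rewrite ler_wpM2r.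
apply: le_trans le2 _; rewrite -/R; nra.
Qed.

Lemma arcs_in_delete (V : finType) (g : rel V) (S : {set V}) (x : V) :
  symmetric g -> x \in S -> (arcs_in g S <= arcs_in g (S :\ x) + 2 * deg_in g S x)%N.
Proof.
move=> gs xS; rewrite /arcs_in (big_setD1 x xS) /= mul2n -addnn addnA addnC leq_add2r.
have -> : deg_in g S x = (\sum_(y in S) g y x)%N.
  by rewrite /deg_in -sum1dep_card big_mkcondr /=; apply: eq_bigr => y _; rewrite gs; case: (g y x).
rewrite (big_setD1 x xS) /= addnCA; apply: leq_trans (leq_addl _ _).
rewrite -big_split /=; apply: leq_sum => y _; rewrite /deg_in (cardsD1 x) addnC inE xS /=.
by rewrite leq_add2r; apply: eq_leq; apply: eq_card => z; rewrite !inE andbA.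
Qed.

(* Maximizing [arcs_in g X - lam * |X|^2] replaces the iterated deletion of vertices of low degree. *)
Lemma exists_min_degree_subset (V : finType) (g : rel V) (lam : rat) :
  symmetric g -> lam <= 2 ->
  exists2 S : {set V},
    forall X : {set V}, (arcs_in g X)%:R - lam * #|X|%:R ^+ 2 <= (arcs_in g S)%:R - lam * #|S|%:R ^+ 2 &
    forall x, x \in S -> lam * #|S|%:R - 1 <= (deg_in g S x)%:R.
Proof.
move=> gs lam2; pose phi (X : {set V}) : rat := (arcs_in g X)%:R - lam * #|X|%:R ^+ 2.
have [S _ Smax0] := @arg_maxP _ _ _ set0 predT phi isT.
have Smax X : phi X <= phi S by exact: Smax0.
exists S => [X|x xS]; first exact: Smax.
have := Smax (S :\ x); rewrite /phi => le1.
have := arcs_in_delete gs xS; rewrite -(ler_nat rat) natrD natrM => le2.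
move: le1; rewrite (cardsD1 x S) xS add1n -natr1 expr2 => le1.
have : lam * (2 * (#|S :\ x|%:R + 1) - 1) <= 2 * (deg_in g S x)%:R.
  lra.
lra.
Qed.

(** A Turan bound with error term. Every [X] is compared with a maximizer [S] of [arcs_in] minus a
    multiple of the squared size: either [S] is too small to matter, or it has a partition with few
    inner arcs. *)
Lemma arcs_in_le_of_few_cliques (r : nat) (eps : rat) :
  (0 < r)%N -> 0 < eps -> 4 * r%:R ^+ 2 * eps <= 1 ->
  exists eps0 : rat, 0 < eps0 /\ exists n0 : nat,
  forall (V : finType) (g : rel V), symmetric g -> (n0 < #|V|)%N ->
  #|cliques g (option 'I_r)|%:R <= eps0 * #|V|%:R ^+ r.+1 ->
  forall X : {set V},
    (arcs_in g X)%:R <= (1 - r%:R^-1) * #|X|%:R ^+ 2 + 4 * r%:R * eps * #|V|%:R ^+ 2.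
Proof.
move=> r0 e0 er.
have e15 : 0 < eps / 5 by lra.
have [eps0 [eps00 [n0 H]]] := min_degree_partition r0 e0 er e15.
exists eps0; split=> //; exists n0 => V g gs nV hcl X.
have R1 : 1 <= r%:R :> rat by rewrite ler1n.
have Rinv0 : 0 < r%:R^-1 :> rat by rewrite invr_gt0; lra.
have [|S Smax Sdeg] := @exists_min_degree_subset V g (1 - r%:R^-1 - eps) gs; first lra.
have := Smax X; set R : rat := r%:R in R1 Rinv0 *; set n : rat := #|V|%:R in hcl *.
set s : rat := #|S|%:R in Sdeg *; set x : rat := #|X|%:R.
have Xn : 0 <= x ^+ 2 by rewrite exprn_ge0.
have n_ge0 : 0 <= n by [].
have s_ge0 : 0 <= s by [].
have sn : s <= n by rewrite ler_nat max_card.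
have n2 : 0 <= n ^+ 2 by rewrite exprn_ge0.
have e1 : eps <= 1.
  have : 1 * eps <= R ^+ 2 * eps by rewrite ler_pM2r // expr_ge1 //; lra.
  by move: er; rewrite -/R; lra.
have eRn : eps * n ^+ 2 <= R * eps * n ^+ 2.
  by rewrite ler_wpM2r // ler_peMl //; lra.
have ex : 0 <= eps * x ^+ 2 by rewrite mulr_ge0; lra.
have [small|big] := ltP s (eps * n).
  have arcs_s : (arcs_in g S)%:R <= s ^+ 2.
    rewrite expr2 -natrM ler_nat /arcs_in -sum_nat_const leq_sum // => y _.
    by apply: subset_leq_card; apply/subsetP => z; rewrite inE => /andP[].
  have s2 : s ^+ 2 <= eps * n ^+ 2.
    have : s * s <= (eps * n) * n by rewrite ler_pM // ltW.
    by rewrite -mulrA !expr2.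
  have Rs : R^-1 * s ^+ 2 <= s ^+ 2.
    by rewrite ler_piMl ?exprn_ge0 // invf_le1; lra.
  have es : eps * s ^+ 2 <= s ^+ 2 by rewrite ler_piMl ?exprn_ge0.
  nra.
have [p hp] := H V g S gs nV hcl big Sdeg.
have := arcs_in_le_inner g p S r0; rewrite -/s -/R.
move: hp; rewrite -/n -/R.
have es : eps * s ^+ 2 <= eps * n ^+ 2 by rewrite ler_pM2l // lerXn2r.
nra.
Qed.

Lemma inner_arcs_restrict (V : finType) (g : rel V) (r : nat) (p : V -> 'I_r) (S : {set V}) :
  (inner_arcs g p setT <= inner_arcs g p S + 2 * (#|~: S| * #|V|))%N.
Proof.
rewrite !inner_arcs_pairs; set A := [set z | _]; set B := [set z | _].
have sub : A \subset B :|: (setX (~: S) setT :|: setX setT (~: S)).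
  apply/subsetP => -[x y]; rewrite !inE /= => /andP[-> ->].
  by case: (x \in S); case: (y \in S).
apply: leq_trans (subset_leq_card sub) _.
apply: leq_trans (leq_card_setU _ _) _; rewrite leq_add2l.
apply: leq_trans (leq_card_setU _ _) _.
by rewrite !cardsX !cardsT [(#|V| * _)%N]mulnC addnn -mul2n.
Qed.

(** The partition found on the set [S] of large minimum degree serves the whole graph because [S]
    turns out to contain almost all vertices. *)
Lemma stability (r : nat) (delta : rat) :
  (0 < r)%N -> 0 < delta ->
  exists eps0 : rat, 0 < eps0 /\ exists n0 : nat,
  forall (V : finType) (g : rel V), symmetric g -> (n0 < #|V|)%N ->
  #|cliques g (option 'I_r)|%:R <= eps0 * #|V|%:R ^+ r.+1 ->
  (1 - r%:R^-1) * #|V|%:R ^+ 2 - #|V|%:R <= (arcs_in g setT)%:R :> rat ->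
  exists p : V -> 'I_r, (inner_arcs g p setT)%:R <= delta * #|V|%:R ^+ 2.
Proof.
move=> r0 d0; pose R : rat := r%:R.
have R1 : 1 <= R by rewrite ler1n.
have Rinv0 : 0 < R^-1 by rewrite invr_gt0; lra.
have [d1 [d10 d11 d1d]] : exists d1 : rat, [/\ 0 < d1, d1 <= 1 & d1 <= delta].
  by have [h|h] := leP delta 1; [exists delta | exists 1]; split=> //; rewrite ltW.
(* Maximality of [S] against the whole vertex set will give [eps (n^2 - s^2) <= n + 4 R eps2 n^2].
   So [eps2] must be small compared with [eps]; here [4 R eps2 = eps d1 / 8]. *)
pose eps := d1 / (8 * R ^+ 2); pose eps2 := eps * d1 / (32 * R).
have R2 : 1 <= R ^+ 2 by rewrite expr_ge1 //; lra.
have e0 : 0 < eps by rewrite divr_gt0; lra.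
have e20 : 0 < eps2 by apply: divr_gt0; [apply: mulr_gt0 | lra].
have eE : 8 * R ^+ 2 * eps = d1 by rewrite /eps mulrC divfK // lt0r_neq0; lra.
have e2E : 32 * R * eps2 = eps * d1 by rewrite /eps2 mulrC divfK // lt0r_neq0; lra.
have er : 4 * r%:R ^+ 2 * eps <= 1 by rewrite -/R; lra.
have eR : 8 * (R * eps) <= d1.
  have : 1 * (R * eps) <= R * (R * eps) by rewrite ler_wpM2r // mulr_ge0; lra.
  by move: eE; rewrite expr2; lra.
have e1 : eps <= 1 / 8.
  have : 1 * eps <= R * eps by rewrite ler_wpM2r; lra.
  lra.
have e2r : 4 * r%:R ^+ 2 * eps2 <= 1.
  have : 32 * R ^+ 2 * eps2 = R * eps * d1 by rewrite expr2; transitivity (R * (32 * R * eps2)); [ring | rewrite e2E; ring].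
  have Re0 : 0 <= R * eps by apply: mulr_ge0; [lra | exact: ltW].
  have : R * eps * d1 <= 1 * 1 by apply: ler_pM; [exact: Re0 | exact: ltW | lra | exact: d11].
  rewrite -/R; lra.
have d20 : 0 < d1 / 20 by lra.
have [ea [ea0 [na Ha]]] := min_degree_partition r0 e0 er d20.
have [eb [eb0 [nb Hb]]] := arcs_in_le_of_few_cliques r0 e20 e2r.
have [nc Hc] := nat_above (8 / (eps * d1)).
have [e [e_0 ea_e eb_e]] : exists e : rat, [/\ 0 < e, e <= ea & e <= eb].
  by have [h|h] := leP ea eb; [exists ea | exists eb]; split=> //; rewrite ltW.
exists e; split=> //; exists (maxn na (maxn nb nc)) => V g gs.
rewrite !gtn_max => /and3P[nna nnb /Hc nnc] hcl harcs.
have [|S Smax Sdeg] := @exists_min_degree_subset V g (1 - R^-1 - eps) gs; first lra.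
have := Smax setT; rewrite cardsT.
have hcl' e' : e <= e' -> #|cliques g (option 'I_r)|%:R <= e' * #|V|%:R ^+ r.+1.
  by move=> le; apply: le_trans hcl _; rewrite ler_wpM2r // exprn_ge0.
have := Hb V g gs nnb (hcl' _ eb_e) S.
have HS := Ha V g S gs nna (hcl' _ ea_e).
have hcS : #|~: S|%:R = #|V|%:R - #|S|%:R :> rat by rewrite -(cardsC S) natrD addrAC subrr add0r.
move: nnc HS harcs Smax Sdeg hcS; rewrite -/R.
set n : rat := #|V|%:R; set s : rat := #|S|%:R => nnc HS harcs Smax Sdeg hcS leb lev.
have s_ge0 : 0 <= s by [].
have sn : s <= n by rewrite ler_nat max_card.
have ed : 0 < eps * d1 by apply: mulr_gt0.
have n0 : 0 < n by apply: lt_le_trans nnc; apply: divr_gt0; [|exact: ed].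
have nn : 8 * n <= eps * d1 * n ^+ 2.
  by move: nnc; rewrite (ler_pdivrMr _ _ ed) -(ler_pM2r n0) expr2; clear; lra.
have s2 : (1 - d1 / 4) * n ^+ 2 <= s ^+ 2.
  rewrite -(ler_pM2l e0); have : 4 * R * eps2 * n ^+ 2 = eps * d1 * n ^+ 2 / 8.
    by rewrite -e2E; field.
  by move: leb lev harcs; rewrite -/R; lra.
have sn1 : (1 - d1 / 4) * n <= s.
  rewrite -(ler_pM2r n0) -mulrA -expr2; apply: le_trans s2 _.
  by rewrite expr2 ler_wpM2l.
have big : eps * n <= s.
  have : eps * n <= 1 / 8 * n by rewrite ler_pM2r.
  have : d1 * n <= 1 * n by rewrite ler_pM2r.
  lra.
have [p hp] := HS big Sdeg.
exists p; have := inner_arcs_restrict g p S.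
rewrite -(ler_nat rat) natrD !natrM hcS -/n => le1.
have n2 : 0 <= n ^+ 2 by rewrite exprn_ge0 // ltW.
have b1 : (n - s) * n <= d1 / 4 * n ^+ 2.
  by rewrite expr2 mulrA (ler_pM2r n0); move: sn1; clear; lra.
have b2 : (2 * R * eps + 5 * (d1 / 20)) * n ^+ 2 <= d1 / 2 * n ^+ 2.
  by apply: (ler_wpM2r n2); move: eR; clear; lra.
have b3 : d1 * n ^+ 2 <= delta * n ^+ 2 by rewrite ler_wpM2r.
by move: hp le1 b1 b2 b3; rewrite -/R; clear; lra.
Qed.

(** * Structure of graphs with few copies *)

Section Partition.
Variables (V : finType) (g : rel V) (r : nat) (p : V -> 'I_r).
Hypotheses (g_sym : symmetric g) (g_irr : irreflexive g).

Definition cross_arcs : nat := #|[set z : V * V | p z.1 != p z.2]|.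
Definition missing_deg (u : V) : nat := #|[set w | (p u != p w) && ~~ g u w]|.
Definition inner_deg (u : V) : nat := #|[set w | g u w && (p u == p w)]|.

Lemma inner_arcs_degE : inner_arcs g p setT = (\sum_u inner_deg u)%N.
Proof.
rewrite /inner_arcs (eq_bigl predT) => [|x]; last by rewrite inE.
by apply: eq_bigr => x _; apply: eq_card => y; rewrite !inE.
Qed.

Lemma arcs_cross : (arcs_in g setT + \sum_u missing_deg u = inner_arcs g p setT + cross_arcs)%N.
Proof.
rewrite inner_arcs_degE /cross_arcs (card_pairs (fun x y => p x != p y)) /arcs_in.
rewrite (eq_bigl predT) => [|x]; last by rewrite inE.
rewrite -!big_split /=; apply: eq_bigr => x _; rewrite /deg_in /missing_deg /inner_deg.
rewrite -(cardsID [set w | p x == p w] [set y in setT | g x y]) -addnA; congr addn.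
  by apply: eq_card => y; rewrite !inE.
rewrite -(cardsID [set w | g x w] [set y | p x != p y]); congr addn.
all: by apply: eq_card => y; rewrite !inE /= 1?andbC.
Qed.

(** The hypothesis says that the graph has at least as many edges as the complete multipartite graph
    of [p]; it turns bounds on inner arcs into bounds on missing ones. *)
Lemma missing_le_inner :
  (cross_arcs <= arcs_in g setT)%N -> (\sum_u missing_deg u <= inner_arcs g p setT)%N.
Proof. by move: arcs_cross; lia. Qed.

Lemma cross_arcs_parts :
  (cross_arcs + \sum_(i < r) #|[set y | p y == i]| ^ 2 = #|V| ^ 2)%N.
Proof.
have -> : (\sum_(i < r) #|[set y | p y == i]| ^ 2 = \sum_(x in setT) #|[set y in setT | p x == p y]|)%N.
  rewrite sum_same_part; apply: eq_bigr => i _; congr (_ ^ 2)%N.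
  by apply: eq_card => y; rewrite !inE.
rewrite /cross_arcs (card_pairs (fun x y => p x != p y)).
rewrite [X in (_ + X)%N](eq_bigl predT) => [|x]; last by rewrite inE.
rewrite -big_split /= (eq_bigr (fun=> #|V|)) ?sum_nat_const // => x _.
rewrite addnC -[RHS](cardC [pred y | p x == p y]).
by congr addn; apply: eq_card => y; rewrite !inE.
Qed.

Lemma inner_arcs_remove u :
  inner_arcs g p setT = (inner_arcs g p [set~ u] + 2 * inner_deg u)%N.
Proof.
rewrite inner_arcs_degE (bigD1 u) //= /inner_arcs.
have h : (inner_deg u = \sum_(x in [set~ u]) (g x u && (p x == p u)))%N.
  rewrite /inner_deg -sum1dep_card big_mkcond (bigD1 u) //= g_irr /= add0n.
  rewrite [RHS](eq_bigl (fun x => x != u)); last by move=> x; rewrite !inE.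
  by apply: eq_bigr => x _; rewrite g_sym eq_sym; case: (_ && _).
rewrite mul2n -addnn addnA [RHS]addnC; congr addn; rewrite h -big_split /=.
rewrite [RHS](eq_bigl (fun x => x != u)); last by move=> x; rewrite !inE.
apply: eq_bigr => x _; rewrite /inner_deg (cardsD1 u) inE addnC; congr addn.
by apply: eq_card => y; rewrite !inE andbA.
Qed.

End Partition.

Section MaxCut.
Variables (V : finType) (g : rel V) (r : nat) (p : V -> 'I_r).
Hypotheses (g_sym : symmetric g) (g_irr : irreflexive g).

(** Moving [u] to part [j] changes only the inner arcs at [u], so minimality compares its degrees
    into the two parts. *)
Lemma max_cut_degree u j :
  (forall q : V -> 'I_r, inner_arcs g p setT <= inner_arcs g q setT)%N ->
  (inner_deg g p u <= #|[set w | g u w && (p w == j)]|)%N.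
Proof.
move=> /(_ (fun w => if w == u then j else p w)).
rewrite (inner_arcs_remove p g_sym g_irr u) [X in (_ <= X)%N](inner_arcs_remove _ g_sym g_irr u).
set q := fun w => _.
have -> : inner_arcs g q [set~ u] = inner_arcs g p [set~ u].
  apply: eq_bigr => x; rewrite !inE => xu; apply: eq_card => y; rewrite !inE /q (negbTE xu).
  by case: eqP.
rewrite leq_add2l leq_mul2l /= => /leq_trans; apply; rewrite /inner_deg /q eqxx.
apply: subset_leq_card; apply/subsetP => w; rewrite !inE.
by have [->|wu] := eqVneq w u; rewrite ?g_irr // eq_sym.
Qed.

End MaxCut.

(** * Embeddings of a critical graph *)

Lemma card_noninjective (I V : finType) :
  (#|[set f : {ffun I -> V} | ~~ injectiveb f]| <= #|I| ^ 2 * #|V| ^ #|I|.-1)%N.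
Proof.
have [/card0_eq V0|/card_gt0P[v0 _]] := posnP #|V|.
  rewrite (_ : [set _ | _] = set0) ?cards0 //; apply/setP => f; rewrite !inE.
  by apply/negbTE; rewrite negbK; apply/injectiveP => i; have := V0 (f i).
pose D (z : I * I) := [set f : {ffun I -> V} | (z.1 != z.2) && (f z.1 == f z.2)].
have sub : [set f : {ffun I -> V} | ~~ injectiveb f] \subset \bigcup_z D z.
  apply/subsetP => f; rewrite inE => /injectivePn[i [j ij fij]].
  by apply/bigcupP; exists (i, j) => //; rewrite inE /= ij fij eqxx.
apply: leq_trans (subset_leq_card sub) _.
have le (z : I * I) : (#|D z| <= #|V| ^ #|I|.-1)%N.
  have <- : #|~: [set z.1]| = #|I|.-1 by rewrite cardsCs setCK cards1 subn1.
  rewrite -(card_prescribed _ (fun=> v0)).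
  apply: (leq_card_inj (h := fun f : {ffun I -> V} => [ffun i => if i == z.1 then v0 else f i])).
    move=> f f'; rewrite !inE => /andP[z12 /eqP fz] /andP[_ /eqP fz'] /ffunP eqf.
    have eqf' i : i != z.1 -> f i = f' i by move=> /negbTE iz; have := eqf i; rewrite !ffunE iz.
    apply/ffunP => i; have [->|/eqf'//] := eqVneq i z.1.
    by rewrite fz fz' eqf' // eq_sym.
  by move=> f _; rewrite inE; apply/forall_inP => i; rewrite inE => /eqP ->; rewrite ffunE eqxx.
apply: (@leq_trans (\sum_(z : I * I) #|V| ^ #|I|.-1)%N); last first.
  by rewrite sum_nat_const card_prod mulnn.
elim/big_ind2: _ => [|m1 n1 m2 n2 h1 h2|z _]; rewrite ?cards0 //.
by apply: leq_trans (leq_card_setU _ _) _; apply: leq_add.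
Qed.

Definition embeddings (I V : finType) (h : rel I) (g : rel V) : {set {ffun I -> V}} :=
  [set f : {ffun I -> V} | injectiveb f && [forall i, forall j, h i j ==> g (f i) (f j)]].

Lemma embeddingsP (I V : finType) (h : rel I) (g : rel V) (f : {ffun I -> V}) :
  reflect (injective f /\ forall i j, h i j -> g (f i) (f j)) (f \in embeddings h g).
Proof.
rewrite inE; apply: (iffP andP) => [[/injectiveP fi /forallP fg]|[fi fg]]; split=> //.
- by move=> i j; apply: (implyP (forallP (fg i) j)).
- by apply/injectiveP.
by apply/forallP => i; apply/forallP => j; apply/implyP/fg.
Qed.

(** Criticality as used for embeddings: [c] is a proper colouring of [F - xy] in which [x] and [y]
    share a colour and every colour occurs. *)
Definition almost_proper (I : finType) (h : rel I) (x y : I) (r : nat) (c : I -> 'I_r) : Prop :=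
  [/\ x != y, c x = c y, forall a, exists i, c i = a &
      forall i j, h i j -> [\/ c i != c j, (i = x /\ j = y) | (i = y /\ j = x)]].

(** Giving [y] a class of its own turns [c] into a homomorphism to the complete graph on
    [option 'I_r]. By [blowup_count] many cliques then give a positive proportion of all maps, of
    which only [O(n^(#|I|-1))] are not injective. *)
Lemma few_cliques_of_few_embeddings (I : finType) (h : rel I) (x y : I) (r : nat)
    (c : I -> 'I_r) (eps0 : rat) :
  almost_proper h x y c -> 0 < eps0 ->
  exists n0 : nat, forall (V : finType) (g : rel V), (n0 < #|V|)%N ->
  #|embeddings h g|%:R <= #|V|%:R ^+ #|I|.-1 :> rat ->
  #|cliques g (option 'I_r)|%:R <= eps0 * #|V|%:R ^+ r.+1.
Proof.
move=> [xy cxy csurj hc] e0.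
set m := (2 ^ (#|I| - #|{: option 'I_r}|))%N.
have em : 0 < eps0 ^+ m by rewrite exprn_gt0.
have [n0 hn0] := nat_above (((#|I| ^ 2)%N%:R + 2) / eps0 ^+ m).
exists n0 => V g nV; have {hn0} := hn0 _ nV; rewrite ler_pdivrMr // => hn hemb.
have V0 : (0 < #|V|)%N by apply: leq_ltn_trans nV.
have [v0 _] := card_gt0P V0.
rewrite leNgt; apply/negP => /ltW hcl.
pose tau i := if i == y then None else Some (c i).
pose sigma (o : option 'I_r) := if o is Some a then
   (if [pick i | (i != y) && (c i == a)] is Some i then i else x) else y.
have sK : cancel sigma tau.
  case=> [a|] /=; rewrite /tau /sigma ?eqxx //.
  case: pickP => [i /andP[/negbTE -> /eqP ->] //|none].
  have [i ci] := csurj a; have := none i; rewrite ci eqxx andbT => /negbT; rewrite negbK => /eqP iy.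
  by have := none x; rewrite xy cxy -iy ci eqxx.
have cardo : #|{: option 'I_r}| = r.+1 by rewrite card_option card_ord.
have := @blowup_count V g I _ tau v0 sigma eps0 sK V0 (ltW e0).
rewrite cardo => /(_ hcl); rewrite -cardo -/m.
set H := [set f | _] => hH.
have sub : H \subset embeddings h g :|: [set f : {ffun I -> V} | ~~ injectiveb f].
  apply/subsetP => f; rewrite inE => /forallP fg; rewrite !inE orbC.
  case: (injectiveb f) => //=; apply/forallP => i; apply/forallP => j; apply/implyP => hij.
  apply: (implyP (forallP (fg i) j)); rewrite /tau.
  case: (hc _ _ hij) => [cij|[-> ->]|[-> ->]]; rewrite ?eqxx ?(negbTE xy) //.
  case: (eqVneq i y) cij => [->|iy]; case: (eqVneq j y) => [->|jy] //.
  by rewrite eqxx.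
have I0 : (0 < #|I|)%N by apply/card_gt0P; exists x.
have le1 : #|H|%:R <= ((#|I| ^ 2)%N%:R + 1) * #|V|%:R ^+ #|I|.-1 :> rat.
  apply: (@le_trans _ _ (#|embeddings h g| + #|I| ^ 2 * #|V| ^ #|I|.-1)%N%:R).
    rewrite ler_nat; apply: leq_trans (subset_leq_card sub) _.
    apply: leq_trans (leq_card_setU _ _) _; rewrite leq_add2l; exact: card_noninjective.
  rewrite natrD natrM [(_ ^ _.-1)%:R]natrX; lra.
have := le_trans hH le1; rewrite -[X in _ * _ ^+ X](prednK I0) exprS mulrA.
have Vm : 0 < #|V|%:R ^+ #|I|.-1 :> rat by rewrite exprn_gt0 // ltr0n.
by rewrite ler_pM2r //; lra.
Qed.

Lemma leq_cardD (T : finType) (A B : {set T}) : (#|A| <= #|A :\: B| + #|B|)%N.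
Proof. by rewrite -(cardsID B A) addnC leq_add2l subset_leq_card // subsetIr. Qed.

(** The compatibility relation asks for distinct images and for adjacency across parts. A vertex
    outside [X] rules out itself and the vertices it misses, whence [N + 1]. *)
Lemma greedy_typical (I V : finType) (g : rel V) (r : nat) (p : V -> 'I_r) (X : {set V})
    (C : I -> {set V}) (f0 : I -> V) (L N : rat) (s : seq I) :
  symmetric g -> (forall w, w \notin X -> (missing_deg g p w)%:R <= N) ->
  uniq s -> 0 <= L -> 0 <= N -> (forall i, [disjoint C i & X]) ->
  {in s, forall i, L + (size s)%:R * (N + 1) <= #|C i|%:R} ->
  L ^+ size s <= #|greedy_maps C (fun _ _ w w' => (w != w') && ((p w != p w') ==> g w w')) f0 s|%:R.
Proof.
move=> gs hX us L0 N0 CX hC; apply: (@greedy_count V I C _ f0 L (N + 1)) => //.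
- by move=> _ _ w w'; rewrite eq_sym gs [p w == _]eq_sym.
- by lra.
- move=> i si; apply: le_trans (hC i si); rewrite lerD2l ler_wpM2r ?ler_nat ?leq_pred //; lra.
move=> i j si sj ij w wC.
have wX : w \notin X by have /disjointFr := CX i => ->.
apply: (@le_trans _ _ (missing_deg g p w + 1)%N%:R); last by rewrite natrD lerD2r hX.
rewrite ler_nat /missing_deg -(cards1 w).
apply: leq_trans (leq_card_setU _ _); apply: subset_leq_card; apply/subsetP => w'.
rewrite !inE negb_and negbK negb_imply => /andP[_ /orP[/eqP ->|->]].
  by rewrite !eqxx.
by [].
Qed.

Section Embed.
Variables (I : finType) (h : rel I) (x y : I) (r : nat) (c : I -> 'I_r).
Hypothesis hc : almost_proper h x y c.

Lemma almost_proper_irr i : h i i = false.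
Proof.
case: hc => xy _ _ hh; apply/negP => /hh[|[ix iy]|[iy ix]]; first by rewrite eqxx.
  by move: xy; rewrite -ix -iy eqxx.
by move: xy; rewrite -ix -iy eqxx.
Qed.

Variables (V : finType) (g : rel V) (p : V -> 'I_r) (X : {set V}) (L N : rat).
Hypotheses (g_sym : symmetric g) (g_irr : irreflexive g).
Hypotheses (typical : forall w, w \notin X -> (missing_deg g p w)%:R <= N).
Hypotheses (L0 : 0 <= L) (N0 : 0 <= N).

(** [x] goes to [u], and every other vertex to a neighbour of [u] in the part of its colour. This
    takes care of all edges at [x], including the monochromatic [xy]; the other edges cross
    parts. *)
Lemma embeddings_of_inner_deg (u : V) (D : rat) :
  (forall j, D <= #|[set w | g u w && (p w == j)]|%:R) ->
  L + #|I|%:R * (N + 1) + #|X|%:R <= D ->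
  L ^+ #|I|.-1 <= #|embeddings h g|%:R.
Proof.
move=> hD hL; case: (hc) => xy cxy _ hh.
pose c' i := tperm (c x) (p u) (c i).
have c'E i j : (c' i == c' j) = (c i == c j) by rewrite (inj_eq perm_inj).
pose C i := [set w | g u w && (p w == c' i)] :\: X.
have sE : size (enum [set~ x]) = #|I|.-1 by rewrite -cardE cardsC1.
rewrite -sE; set s := enum _ in sE *.
have sP i : (i \in s) = (i != x) by rewrite mem_enum !inE.
apply: le_trans (_ : _ <= #|greedy_maps C (fun _ _ w w' => (w != w') && ((p w != p w') ==> g w w'))
   (fun=> u) s|%:R) _.
  apply: (@greedy_typical I V g r p X C _ L N s) => //; first exact: enum_uniq.
    move=> i; rewrite -setI_eq0 /C; apply/eqP/setP => w; rewrite !inE.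
    by case: (w \in X); rewrite ?andbF.
  move=> i _; have := hD (c' i).
  have := leq_cardD [set w | g u w && (p w == c' i)] X; rewrite -(ler_nat rat) natrD -/(C i).
  have : (size s)%:R * (N + 1) <= #|I|%:R * (N + 1).
    by rewrite sE; apply: ler_wpM2r; [rewrite addr_ge0 | rewrite ler_nat leq_pred].
  lra.
rewrite ler_nat; apply: subset_leq_card; apply/subsetP => f /greedy_mapsP[fC f0 fok].
have fx : f x = u by apply: f0; rewrite sP eqxx.
have fN i : i != x -> g u (f i) by rewrite -sP => /fC; rewrite !inE => /and3P[].
have fp i : i != x -> p (f i) = c' i by rewrite -sP => /fC; rewrite !inE => /and3P[_ _ /eqP].
apply/embeddingsP; split=> [i j|i j hij].
  have [->|ix] := eqVneq i x; have [->|jx] := eqVneq j x => //.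
  - by rewrite fx => e; have := fN j jx; rewrite -e g_irr.
  - by rewrite fx => e; have := fN i ix; rewrite e g_irr.
  have [//|ij] := eqVneq i j; have := fok i j; rewrite !sP => /(_ ix jx ij) /andP[+ _] e.
  by rewrite e eqxx.
have ij : i != j by apply: contraTneq hij => ->; rewrite almost_proper_irr.
have [ix|ix] := eqVneq i x; first by rewrite ix fx fN // -ix eq_sym.
have [jx|jx] := eqVneq j x; first by rewrite jx fx g_sym fN.
have := fok i j; rewrite !sP => /(_ ix jx ij) /andP[_ /implyP]; apply.
rewrite !fp // c'E; case: (hh _ _ hij) => // -[e1 e2].
  by rewrite e1 eqxx in ix.
by rewrite e2 eqxx in jx.
Qed.

(** Prescribing [f x] and [f y], rather than the edge [uv], makes these sets disjoint for distinct
    ordered pairs. *)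
Definition exclusive_embeddings (u v : V) : {set {ffun I -> V}} :=
  [set f in embeddings h g | [&& f x == u, f y == v &
    [forall i, forall j, h i j && (p (f i) == p (f j)) ==>
      ((i == x) && (j == y) || (i == y) && (j == x))]]].

(** The other vertices are placed greedily in the parts of their colours. What [P] must absorb is
    [#|X|] for the atypical vertices, [2] for [u] and [v], [2 * N2] for the vertices missed by [u]
    or [v], and [N + 1] per placed vertex. *)
Lemma exclusive_embeddings_ge (u v : V) (P N2 : rat) :
  g u v -> p u = p v -> (missing_deg g p u)%:R <= N2 -> (missing_deg g p v)%:R <= N2 ->
  (forall j, P <= #|[set w | p w == j]|%:R) ->
  L + #|I|%:R * (N + 1) + #|X|%:R + 2 + 2 * N2 <= P ->
  L ^+ (#|I| - 2) <= #|exclusive_embeddings u v|%:R.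
Proof.
move=> guv puv mu mv hP hL; case: (hc) => xy cxy _ hh.
(* Exchanging two colours sends the common colour of [x] and [y] to the common part of [u] and
   [v]. *)
pose c' i := tperm (c x) (p u) (c i).
have c'E i j : (c' i == c' j) = (c i == c j) by rewrite (inj_eq perm_inj).
have c'x : c' x = p u by rewrite /c' tpermL.
pose M w0 := [set w | (p w0 != p w) && ~~ g w0 w].
pose C i := [set w | p w == c' i] :\: X :\: [set u; v] :\: M u :\: M v.
have sE : size (enum (~: [set x; y])) = (#|I| - 2)%N.
  by rewrite -cardE cardsCs setCK cards2 xy.
rewrite -sE; set s := enum _ in sE *.
have sP i : (i \in s) = (i != x) && (i != y) by rewrite mem_enum !inE negb_or.
apply: le_trans (_ : _ <= #|greedy_maps C (fun _ _ w w' => (w != w') && ((p w != p w') ==> g w w'))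
   (fun i => if i == x then u else v) s|%:R) _.
  apply: (@greedy_typical I V g r p X C _ L N s) => //; first exact: enum_uniq.
    move=> i; rewrite -setI_eq0 /C; apply/eqP/setP => w; rewrite !inE.
    by case: (w \in X); rewrite ?andbF.
  move=> i _; have := hP (c' i).
  have := leq_cardD [set w | p w == c' i] X.
  have := leq_cardD ([set w | p w == c' i] :\: X) [set u; v].
  have := leq_cardD ([set w | p w == c' i] :\: X :\: [set u; v]) (M u).
  have := leq_cardD ([set w | p w == c' i] :\: X :\: [set u; v] :\: M u) (M v).
  rewrite -!(ler_nat rat) !natrD -/(C i) -[#|M u|]/(missing_deg g p u) -[#|M v|]/(missing_deg g p v).
  have : #|[set u; v]|%:R <= 2 :> rat by rewrite cards2 ler_nat; case: (u != v).
  have : (size s)%:R * (N + 1) <= #|I|%:R * (N + 1).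
    by rewrite sE; apply: ler_wpM2r; [rewrite addr_ge0 | rewrite ler_nat leq_subr].
  lra.
rewrite ler_nat; apply: subset_leq_card; apply/subsetP => f /greedy_mapsP[fC f0 fok].
have fx : f x = u by rewrite f0 ?eqxx // sP eqxx.
have fy : f y = v by rewrite f0 ?[y == x]eq_sym ?(negbTE xy) // sP eqxx andbF.
have fCs i : i \in s -> [/\ f i != u, f i != v, p (f i) = c' i & (p u != p (f i) -> g u (f i) /\ g v (f i))].
  move=> /fC; rewrite !inE -puv => /and5P[m1 m2 m3 _ /eqP fp].
  move: m3; rewrite negb_or => /andP[-> ->]; split=> // pu.
  by move: m1 m2; rewrite pu /= !negbK => -> ->.
have fp i : p (f i) = c' i.
  have [->|ix] := eqVneq i x; first by rewrite fx c'x.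
  have [->|iy] := eqVneq i y; first by rewrite fy /c' -cxy tpermL.
  by case: (fCs i); rewrite ?sP ?ix.
rewrite inE fx fy !eqxx /=; apply/andP; split; last first.
  apply/forallP => i; apply/forallP => j; apply/implyP => /andP[hij].
  rewrite !fp c'E => /eqP cij; case: (hh _ _ hij) => [|[-> ->]|[-> ->]]; rewrite ?eqxx ?orbT //.
  by rewrite cij eqxx.
have uv : u != v by apply: contraTneq guv => ->; rewrite g_irr.
have cases i : [\/ i = x, i = y | i \in s].
  have [->|ix] := eqVneq i x; first by constructor 1.
  have [->|iy] := eqVneq i y; first by constructor 2.
  by constructor 3; rewrite sP ix.
apply/embeddingsP; split=> [i j|i j hij].
  case: (cases i) => [->|->|si]; case: (cases j) => [->|->|sj] //; rewrite ?fx ?fy.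
  - by move/eqP; rewrite (negbTE uv).
  - by case: (fCs j sj) => /eqP fu _ _ _ e; case: fu.
  - by move/eqP; rewrite eq_sym (negbTE uv).
  - by case: (fCs j sj) => _ /eqP fu _ _ e; case: fu.
  - by case: (fCs i si) => /eqP fu _ _ _ e; case: fu.
  - by case: (fCs i si) => _ /eqP fu _ _ e; case: fu.
  by have [//|ij] := eqVneq i j; have := fok i j si sj ij => /andP[/eqP].
have ij : i != j by apply: contraTneq hij => ->; rewrite almost_proper_irr.
have cne i0 j0 : h i0 j0 -> i0 \in s \/ j0 \in s -> p (f i0) != p (f j0).
  move=> hij0; rewrite !fp c'E; case: (hh _ _ hij0) => // -[-> ->];
  by rewrite !sP !eqxx ?andbF => -[].
have := cne _ _ hij.
case: (cases i) => [ix|iy|si]; case: (cases j) => [jx|jy|sj]; rewrite ?ix ?iy ?jx ?jy ?fx ?fy //.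
- by rewrite ix jx almost_proper_irr in hij.
- by move/(_ (or_intror sj)) => ne; case: (fCs j sj) => _ _ _ /(_ ne) [].
- by rewrite g_sym.
- by rewrite iy jy almost_proper_irr in hij.
- by rewrite -puv; move/(_ (or_intror sj)) => ne; case: (fCs j sj) => _ _ _ /(_ ne) [].
- by rewrite eq_sym; move/(_ (or_introl si)) => ne; rewrite g_sym; case: (fCs i si) => _ _ _ /(_ ne) [].
- by rewrite -puv eq_sym; move/(_ (or_introl si)) => ne; rewrite g_sym; case: (fCs i si) => _ _ _ /(_ ne) [].
by move/(_ (or_introl si)) => ne; have /andP[_ /implyP] := fok i j si sj ij; apply.
Qed.

End Embed.

(** * Partitions with the fewest inner edges *)

Lemma exists_min_inner (V : finType) (g : rel V) (r : nat) : (0 < r)%N ->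
  exists p : V -> 'I_r, forall q : V -> 'I_r, (inner_arcs g p setT <= inner_arcs g q setT)%N.
Proof.
move=> r0; pose F (p : {ffun V -> 'I_r}) := inner_arcs g p setT.
have [p _ pmin] := @arg_minnP _ [ffun=> Ordinal r0] predT F isT.
exists p => q; apply: leq_trans (pmin [ffun x => q x] isT) _; apply: eq_leq.
by apply: eq_bigr => u _; apply: eq_card => v; rewrite !inE !ffunE.
Qed.

(** The squared deviations of the part sizes from [n / r] add up to the sum of squares minus
    [n^2 / r], which the arc count bounds by [n + delta n^2]. A part below half the average size
    would deviate too much. *)
Lemma part_size_ge (V : finType) (g : rel V) (r : nat) (p : V -> 'I_r) (delta : rat) :
  (0 < r)%N -> (1 - r%:R^-1) * #|V|%:R ^+ 2 - #|V|%:R <= (arcs_in g setT)%:R :> rat ->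
  (inner_arcs g p setT)%:R <= delta * #|V|%:R ^+ 2 ->
  16 * r%:R ^+ 2 * delta <= 1 -> 16 * r%:R ^+ 2 <= #|V|%:R :> rat ->
  forall j, #|V|%:R / (2 * r%:R) <= #|[set w | p w == j]|%:R :> rat.
Proof.
move=> r0; have R1 : 1 <= r%:R :> rat by rewrite ler1n.
have R16 : 0 < 16 * r%:R ^+ 2 :> rat by have := @exprn_ege1 _ 2 _ R1; lra.
set R : rat := r%:R in R1 R16 *; set n : rat := #|V|%:R => harcs hin hd hn j.
pose a i : rat := #|[set w | p w == i]|%:R; rewrite -/(a j).
have sum1 : \sum_i a i = n.
  rewrite /a /n -natr_sum -cardsT -(sum_parts p setT); congr (_%:R).
  by apply: eq_bigr => i _; apply: eq_card => w; rewrite !inE.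
have sum2 : (cross_arcs p)%:R + \sum_i a i ^+ 2 = n ^+ 2.
  rewrite /n -natrX -(cross_arcs_parts p) natrD natr_sum; congr (_ + _).
  by apply: eq_bigr => i _; rewrite natrX.
have arcsE : (arcs_in g setT)%:R + (\sum_u missing_deg g p u)%N%:R =
    (inner_arcs g p setT)%:R + (cross_arcs p)%:R :> rat.
  by rewrite -!natrD arcs_cross.
have m0 : 0 <= (\sum_u missing_deg g p u)%N%:R :> rat by [].
set u := R^-1 in harcs *.
have Ru : R * u = 1 by rewrite /u mulfV // lt0r_neq0 //; lra.
have sumv : \sum_i (a i - n * u) ^+ 2 = \sum_i a i ^+ 2 - n ^+ 2 * u.
  transitivity (\sum_i a i ^+ 2 - 2 * (n * u) * \sum_i a i + R * (n * u) ^+ 2).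
    rewrite (eq_bigr (fun i => a i ^+ 2 + (- (2 * (n * u))) * a i + (n * u) ^+ 2)); last first.
      by move=> i _; ring.
    by rewrite !big_split /= -mulr_sumr sumr_const card_ord mulNr -[_ *+ r]mulr_natl.
  rewrite sum1; transitivity (\sum_i a i ^+ 2 - 2 * n ^+ 2 * u + (R * u) * (n ^+ 2 * u)); first by ring.
  by rewrite Ru; ring.
have n2 : 0 <= n ^+ 2 by rewrite exprn_ge0 //; lra.
have aj : (a j - n * u) ^+ 2 <= n + delta * n ^+ 2.
  apply: (@le_trans _ _ (\sum_i (a i - n * u) ^+ 2)).
    by rewrite (bigD1 j) //= lerDl sumr_ge0 // => i _; rewrite sqr_ge0.
  rewrite sumv; lra.
have u0 : 0 < u by rewrite invr_gt0; lra.
have -> : n / (2 * R) = n * u / 2 by rewrite invfM -/u; field.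
rewrite leNgt; apply/negP => small.
have n0 : 0 < n by exact: lt_le_trans R16 hn.
have big : (n * u / 2) ^+ 2 < (a j - n * u) ^+ 2.
  rewrite -[X in _ < X]sqrrN ltrXn2r // ?nnegrE; nra.
have k1 : 16 * R ^+ 2 * n <= n ^+ 2 by rewrite [n ^+ 2]expr2 ler_wpM2r // ltW.
have k2 : 16 * R ^+ 2 * (delta * n ^+ 2) <= n ^+ 2.
  by rewrite mulrA -[X in _ <= X]mul1r ler_wpM2r.
have k3 : 4 * R ^+ 2 * (n * u / 2) ^+ 2 = n ^+ 2.
  transitivity ((R * u) ^+ 2 * n ^+ 2); first by field.
  by rewrite Ru; ring.
have R2 : 0 < 4 * R ^+ 2 by rewrite mulr_gt0 // exprn_gt0; lra.
have : 4 * R ^+ 2 * (n * u / 2) ^+ 2 < 4 * R ^+ 2 * (n + delta * n ^+ 2).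
  by rewrite ltr_pM2l //; lra.
rewrite k3; nra.
Qed.

Lemma markov_count (T : finType) (F : T -> nat) (t : rat) :
  0 <= t -> t * #|[set u | t < (F u)%:R]|%:R <= (\sum_u F u)%N%:R.
Proof.
move=> t0; rewrite mulr_natr -sumr_const natr_sum big_mkcond.
by apply: ler_sum => u _; rewrite inE; case: ltP => // /ltW.
Qed.

Lemma inner_arcs_split (V : finType) (g : rel V) (r : nat) (p : V -> 'I_r) (X : {set V}) (d : rat) :
  symmetric g -> (forall u, (inner_deg g p u)%:R <= d) ->
  (inner_arcs g p setT)%:R <= (inner_arcs g p (~: X))%:R + 2 * (#|X|%:R * d).
Proof.
move=> gs hd; rewrite inner_arcs_degE.
have le1 : (\sum_u inner_deg g p u <= inner_arcs g p (~: X) + 2 * \sum_(u in X) inner_deg g p u)%N.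
  rewrite (bigID (mem X)) /= mul2n -addnn addnA addnC leq_add2r.
  have -> : (\sum_(u in X) inner_deg g p u = \sum_(u in setT) #|[set w in X | g u w && (p u == p w)]|)%N.
    rewrite (card_sum_count setT X (fun u w => g u w && (p u == p w))).
    by apply: eq_bigr => u _; apply: eq_card => w; rewrite !inE gs eq_sym.
  rewrite [X in (_ <= _ + X)%N](bigID (mem X)) /= /inner_arcs.
  rewrite [X in (_ <= X + _)%N](eq_bigl (fun u => u \notin X)); last by move=> u; rewrite inE.
  rewrite addnCA; apply: leq_trans (leq_addl _ _).
  rewrite [X in (_ <= _ + X)%N](eq_bigl (fun u => u \notin X)); last by move=> u; rewrite inE.
  rewrite -big_split /=; apply: leq_sum => u _.
  apply: leq_trans (leq_card_setU _ _); apply: subset_leq_card; apply/subsetP => w.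
  by rewrite !inE => ->; case: (w \in X); rewrite ?orbT.
have le2 : (\sum_(u in X) inner_deg g p u)%N%:R <= #|X|%:R * d.
  by rewrite natr_sum mulr_natl -sumr_const; apply: ler_sum.
move: le1; rewrite -(ler_nat rat) natrD natrM; lra.
Qed.

Lemma exclusive_embeddings_disjoint (I V : finType) (h : rel I) (x y : I) (g : rel V)
    (r : nat) (p : V -> 'I_r) (A : {set V * V}) (t : rat) :
  (forall z, z \in A -> t <= #|exclusive_embeddings h x y g p z.1 z.2|%:R) ->
  #|A|%:R * t <= #|embeddings h g|%:R.
Proof.
move=> hA; apply: (@le_trans _ _ (\sum_(z in A) #|exclusive_embeddings h x y g p z.1 z.2|)%N%:R).
  by rewrite mulr_natl -sumr_const natr_sum; apply: ler_sum.
rewrite ler_nat; apply: (@leq_trans (\sum_(z in A) #|[set f in embeddings h g | (f x == z.1) && (f y == z.2)]|)%N).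
  apply: leq_sum => z _; apply: subset_leq_card; apply/subsetP => f.
  by rewrite !inE => /and4P[-> -> -> _].
rewrite (card_sum_count A (embeddings h g) (fun z (f : {ffun I -> V}) => (f x == z.1) && (f y == z.2))).
rewrite -sum1_card; apply: leq_sum => f _.
rewrite -(cards1 (f x, f y)); apply: subset_leq_card; apply/subsetP => -[u v].
by rewrite !inE /= => /and3P[_ /eqP -> /eqP ->].
Qed.

(** Roles, in units of [n]: typical vertices miss at most [e1], inner degrees are at most [e'],
    missing degrees at most [e2]. Parts have size at least [16 e2], and [8 e2] survives all
    exclusions, hence [alpha]. The first bound on [eta] rules out inner degrees above [e'], the
    second keeps the inner arcs between good vertices below [e2 / 4]. *)
Lemma structure_constants (R K : rat) (m1 m2 : nat) : 1 <= R -> 2 <= K ->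
  exists e2 e' e1 alpha eta : rat,
  [/\ [/\ 0 < e2, 0 < e', 0 < e1, 0 < alpha & 0 < eta],
      [/\ 32 * R * e2 = 1, 4 * e' = e2, 4 * (K * e1) = e' & 16 * R ^+ 2 * (e1 * e' / 8) <= 1],
      alpha = (8 * e2) ^+ m2 /\ (2 * R)^-1 = 16 * e2 &
      [/\ eta <= 1, eta < (e' / 2) ^+ m1 & 4 * eta <= alpha * e2]].
Proof.
move=> R1 K2.
have [e2 e20 e2R] : exists2 e2 : rat, 0 < e2 & 32 * R * e2 = 1.
  have R32 : 0 < 32 * R by lra.
  by exists (32 * R)^-1; [rewrite invr_gt0 | apply: mulfV; apply: lt0r_neq0].
have [e' e'0 e'E] : exists2 e' : rat, 0 < e' & 4 * e' = e2 by exists (e2 / 4); lra.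
have [e1 e10 e1K] : exists2 e1 : rat, 0 < e1 & 4 * (K * e1) = e'.
  have K4 : 0 < 4 * K by lra.
  exists (e' / (4 * K)); first exact: divr_gt0.
  by rewrite mulrA mulrC; apply: divfK; apply: lt0r_neq0.
have [alpha a0 aE] : exists2 a : rat, 0 < a & a = (8 * e2) ^+ m2.
  by eexists; last by []; apply: exprn_gt0; lra.
have RE : (2 * R)^-1 = 16 * e2.
  have R20 : 2 * R != 0 by apply: lt0r_neq0; lra.
  by apply: (mulfI R20); rewrite (mulfV R20) -[LHS]e2R; ring.
have [t1 t10 t1E] : exists2 t : rat, 0 < t & t = (e' / 2) ^+ m1.
  by eexists; last by []; apply: exprn_gt0; lra.
have [t2 t20 t2E] : exists2 t : rat, 0 < t & t = alpha * e2 by eexists; last by []; apply: mulr_gt0.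
exists e2, e', e1, alpha, (Num.min 1 (Num.min (t1 / 2) (t2 / 4))).
rewrite -t1E -t2E.
have eta_le : Num.min 1 (Num.min (t1 / 2) (t2 / 4)) <= t2 / 4 by rewrite !ge_min lexx !orbT.
have eta_lt : Num.min 1 (Num.min (t1 / 2) (t2 / 4)) < t1.
  by rewrite !gt_min; apply/orP; right; apply/orP; left; lra.
have eta0 : 0 < Num.min 1 (Num.min (t1 / 2) (t2 / 4)).
  by rewrite !lt_min; apply/and3P; split; lra.
have eta_1 : Num.min 1 (Num.min (t1 / 2) (t2 / 4)) <= 1 by rewrite ge_min lexx.
split; [by split | split; [exact: e2R | exact: e'E | exact: e1K | ] | by split; [exact: aE | exact: RE] |
  split; [exact: eta_1 | exact: eta_lt | lra]].
have Re : R * e' <= 1 / 128 by move: e2R; rewrite -e'E; lra.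
have e1e : 2 * e1 <= K * e1 by apply: ler_wpM2r => //; apply: ltW.
have Re1 : R * e1 <= R * e' by apply: ler_wpM2l; lra.
have Re10 : 0 <= R * e1 by apply: mulr_ge0; lra.
have Re0 : 0 <= R * e' by apply: mulr_ge0; lra.
have le1 : R * e1 <= 1 / 128 by lra.
have := ler_pM Re10 Re0 le1 Re.
have -> : 16 * R ^+ 2 * (e1 * e' / 8) = 2 * (R * e1 * (R * e')) by field.
lra.
Qed.

Theorem critical_structure (I : finType) (h : rel I) (x y : I) (r : nat) (c : I -> 'I_r) :
  (0 < r)%N -> almost_proper h x y c ->
  exists alpha eta : rat, [/\ 0 < alpha, 0 < eta & exists n0 : nat,
  forall (V : finType) (g : rel V), symmetric g -> irreflexive g -> (n0 < #|V|)%N ->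
  (1 - r%:R^-1) * #|V|%:R ^+ 2 - #|V|%:R <= (arcs_in g setT)%:R :> rat ->
  (forall p : V -> 'I_r, cross_arcs p <= arcs_in g setT)%N ->
  #|embeddings h g|%:R <= eta * #|V|%:R ^+ #|I|.-1 ->
  exists p : V -> 'I_r, forall u v, g u v -> p u = p v ->
    alpha * #|V|%:R ^+ (#|I| - 2) <= #|exclusive_embeddings h x y g p u v|%:R].
Proof.
move=> r0 hc; pose R : rat := r%:R; pose K : rat := #|I|%:R.
have [xy _ _ _] := hc.
have k2 : (2 <= #|I|)%N.
  have <- : #|[set x; y]| = 2%N by rewrite cards2 xy.
  exact: max_card.
have k1E : #|I|.-1 = (#|I| - 2).+1 by move: k2; lia.
have K2 : 2 <= K by rewrite ler_nat.
have R1 : 1 <= R by rewrite ler1n.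
have [e2 [e' [e1 [alpha [eta [[e20 e'0 e10 a0 eta0] [e2R e'E e1K dR] [alphaE RE] [eta_1 eta_emb eta_al]]]]]]] :=
  @structure_constants R K #|I|.-1 (#|I| - 2) R1 K2.
have [delta d0 deltaE] : exists2 d : rat, 0 < d & d = e1 * e' / 8.
  by eexists; last by []; apply: divr_gt0 => //; apply: mulr_gt0.
rewrite -deltaE in dR.
have [es [es0 [ns Hs]]] := stability r0 d0.
have [nc Hc] := few_cliques_of_few_embeddings hc es0.
have [n1 hn1] := nat_above (16 * K / e'); have [n2 hn2] := nat_above (16 * R ^+ 2).
exists alpha, eta; split; [exact: a0 | exact: eta0 | ].
exists (maxn ns (maxn nc (maxn n1 n2))) => V g gs gi.
rewrite !gtn_max => /and4P[nns nnc /hn1 nn1 /hn2 nn2] harcs hcross hemb.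
set n : rat := #|V|%:R in nn1 nn2 harcs hemb *.
rewrite (ler_pdivrMr _ _ e'0) in nn1.
have n0 : 0 < n by rewrite ltr0n; apply: leq_ltn_trans nns.
have n_pow m : 0 < n ^+ m by rewrite exprn_gt0.
have hcl : #|cliques g (option 'I_r)|%:R <= es * n ^+ r.+1.
  apply: (Hc _ _ nnc); apply: (le_trans hemb).
  by rewrite -[X in _ <= X]mul1r; apply: (ler_wpM2r (ltW (n_pow _)) eta_1).
have [p0 hp0] := Hs V g gs nns hcl harcs.
have [p pmin] := exists_min_inner g r0.
have hp : (inner_arcs g p setT)%:R <= delta * n ^+ 2.
  by apply: le_trans hp0; rewrite ler_nat.
exists p.
set m := (\sum_u missing_deg g p u)%N.
have m_inner : m%:R <= (inner_arcs g p setT)%:R :> rat.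
  by rewrite ler_nat; apply: missing_le_inner; apply: hcross.
(* [X1] is made small by Markov's inequality and is avoided while embedding; [X2], with the larger
   threshold, will be shown empty. *)
pose X1 := [set u | e1 * n < (missing_deg g p u)%:R].
pose X2 := [set u | e2 * n < (missing_deg g p u)%:R].
have e1n : 0 < e1 * n by rewrite mulr_gt0.
have e2n : 0 < e2 * n by rewrite mulr_gt0.
have X1le : 8 * #|X1|%:R <= e' * n.
  have := markov_count (missing_deg g p) (ltW e1n); rewrite -/X1 -/m => le1.
  have : e1 * n * (8 * #|X1|%:R) <= e1 * n * (e' * n).
    have : e1 * n * #|X1|%:R <= delta * n ^+ 2 by apply: le_trans le1 (le_trans m_inner hp).
    by rewrite deltaE expr2; lra.
  by rewrite ler_pM2l.
have typ w : w \notin X1 -> (missing_deg g p w)%:R <= e1 * n by rewrite inE -leNgt.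
have K_e1n : 4 * (K * (e1 * n)) = e' * n by rewrite -e1K; ring.
have inner_small u : (inner_deg g p u)%:R <= e' * n.
  rewrite leNgt; apply/negP => /ltW big.
  have L0 : 0 <= e' / 2 * n by apply: mulr_ge0; [apply: divr_ge0; [exact: ltW |] | exact: ltW].
  have : (e' / 2 * n) ^+ #|I|.-1 <= #|embeddings h g|%:R.
    apply: (@embeddings_of_inner_deg I h x y r c hc V g p X1 _ (e1 * n) gs gi typ L0 (ltW e1n) u (e' * n)).
      by move=> j; apply: le_trans big _; rewrite ler_nat; apply: max_cut_degree.
    rewrite -/K; lra.
  move=> /le_trans /(_ hemb); rewrite exprMn ler_pM2r //.
  by apply/negP; rewrite -ltNge.
have excl u v : u \notin X2 -> v \notin X2 -> g u v -> p u = p v ->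
    alpha * n ^+ (#|I| - 2) <= #|exclusive_embeddings h x y g p u v|%:R.
  rewrite !inE -!leNgt => hu hv guv puv.
  have L0 : 0 <= 8 * e2 * n by rewrite -mulrA; apply: mulr_ge0; [| exact: ltW].
  rewrite alphaE -exprMn.
  apply: (@exclusive_embeddings_ge I h x y r c hc V g p X1 _ (e1 * n) gs gi typ L0 (ltW e1n) u v
      (n / (2 * R)) (e2 * n) guv puv hu hv
      (@part_size_ge V g r p delta r0 harcs hp dR nn2)).
  rewrite -/K RE.
  have e'n : 4 * (e' * n) = e2 * n by rewrite -e'E; ring.
  lra.
suff X20 : X2 = set0 by move=> u v; apply: excl; rewrite X20 inE.
pose B := [set z : V * V | [&& z.1 \in ~: X2, z.2 \in ~: X2, g z.1 z.2 & p z.1 == p z.2]].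
have Ble : 4 * #|B|%:R <= e2 * n.
  have BS z : z \in B -> alpha * n ^+ (#|I| - 2) <= #|exclusive_embeddings h x y g p z.1 z.2|%:R.
    by rewrite inE !in_setC => /and4P[hu hv guv /eqP puv]; apply: excl.
  have := le_trans (exclusive_embeddings_disjoint BS) hemb.
  rewrite k1E exprS [X in X <= _]mulrA [X in _ <= X]mulrA (ler_pM2r (n_pow _)) => le1.
  have le2 : 4 * eta * n <= alpha * e2 * n by apply: (ler_wpM2r (ltW n0) eta_al).
  have : alpha * (4 * #|B|%:R) <= alpha * (e2 * n).
    by move: le1 le2; clear; lra.
  by rewrite (ler_pM2l a0).
have := inner_arcs_split X2 gs inner_small.
rewrite [inner_arcs g p (~: X2)]inner_arcs_pairs -/B => le1.
have := markov_count (missing_deg g p) (ltW e2n); rewrite -/X2 -/m => le2.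
(* Each vertex of [X2] misses more than [e2 n], yet accounts for at most [2 e' n = e2 n / 2] inner
   arcs; adding the [e2 n / 4] inner arcs that avoid [X2] leaves [#|X2| <= 1 / 2]. *)
have : #|X2|%:R <= 1 / 2 :> rat.
  rewrite -(ler_pM2l e2n); move: le1 le2 Ble m_inner; rewrite -e'E; clear; lra.
move=> le3; apply/eqP; rewrite -cards_eq0 -leqn0 -ltnS -(ltr_nat rat).
by move: le3; clear; lra.
Qed.

(** * Edge sets and copies *)

Local Close Scope ring_scope.

Lemma set2_eq (T : finType) (a b c d : T) :
  ([set c; d] == [set a; b]) = ((c == a) && (d == b) || (c == b) && (d == a)).
Proof.
apply/eqP/idP => [e|/orP[] /andP[/eqP -> /eqP ->] //]; last exact: setUC.
have : c \in [set a; b] by rewrite -e set21.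
have : d \in [set a; b] by rewrite -e set22.
have : a \in [set c; d] by rewrite e set21.
have : b \in [set c; d] by rewrite e set22.
rewrite !inE ![a == _]eq_sym ![b == _]eq_sym.
by case: (c == a); case: (c == b); case: (d == a); case: (d == b).
Qed.

Lemma exists_subset_card (T : finType) (A : {set T}) (m : nat) :
  m <= #|A| -> exists2 B : {set T}, B \subset A & #|B| = m.
Proof.
move=> mA; exists [set x in take m (enum A)].
  by apply/subsetP => x; rewrite inE => /mem_take; rewrite mem_enum.
by rewrite cardsE (card_uniqP (take_uniq _ (enum_uniq _))) size_takel // -cardE.
Qed.

Lemma card_union_bound (T U : finType) (A : {set T}) (D : T -> {set U}) (S : {set U}) (M : nat) :
  (forall u, u \in S -> exists2 t, t \in A & u \in D t) ->
  (forall t, t \in A -> #|D t| <= M) -> #|S| <= #|A| * M.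
Proof.
move=> SD DM; apply: (@leq_trans #|\bigcup_(t in A) D t|).
  by apply: subset_leq_card; apply/subsetP => u /SD[t tA ut]; apply/bigcupP; exists t.
rewrite -sum_nat_const; elim/big_rec2: _ => [|t m B tA IH]; first by rewrite cards0.
by apply: leq_trans (leq_card_setU _ _) _; apply: leq_add => //; apply: DM.
Qed.

Section Graph.
Variable n : nat.
Implicit Types (E B : {set {set 'I_n}}).

Definition adj E : rel 'I_n := fun a b => [set a; b] \in E.

Definition complete_partite (r : nat) (p : 'I_n -> 'I_r) : {set {set 'I_n}} :=
  [set e : {set 'I_n} | [exists x, exists y, (p x != p y) && (e == [set x; y])]].

Lemma adj_sym E : symmetric (adj E).
Proof. by move=> a b; rewrite /adj setUC. Qed.

Lemma simple_card E e : simple_graph E -> e \in E -> #|e| = 2.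
Proof. by move=> /forall_inP sE /sE /eqP. Qed.

Lemma simple_sub E B : B \subset E -> simple_graph E -> simple_graph B.
Proof. by move=> /subsetP BE /forall_inP sE; apply/forall_inP => e /BE /sE. Qed.

Lemma simpleU E B : simple_graph E -> simple_graph B -> simple_graph (E :|: B).
Proof. by move=> /forall_inP sE /forall_inP sB; apply/forall_inP => e; rewrite inE => /orP[/sE|/sB]. Qed.

Lemma simple_pair E e : simple_graph E -> e \in E -> exists a b, a != b /\ e = [set a; b].
Proof.
move=> sE eE; have /eqP/cards2P[a [b [ab eab]]] := simple_card sE eE.
by exists a, b.
Qed.

Lemma adj_neq E a b : simple_graph E -> adj E a b -> a != b.
Proof. by move=> sE /(simple_card sE); rewrite cards2; case: (a != b). Qed.

Lemma adj_irr E : simple_graph E -> irreflexive (adj E).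
Proof. by move=> sE a; apply/negP => /(adj_neq sE); rewrite eqxx. Qed.

Lemma card_arcs E : simple_graph E -> #|[set z : 'I_n * 'I_n | adj E z.1 z.2]| = 2 * #|E|.
Proof.
move=> sE; rewrite -sum1dep_card (partition_big (fun z => [set z.1; z.2]) (mem E)) //= mulnC -sum_nat_const.
apply: eq_bigr => e eE; have [a [b [ab eab]]] := simple_pair sE eE.
rewrite sum1dep_card -[RHS](_ : #|[set (a, b); (b, a)]| = 2); last first.
  by rewrite cards2 xpair_eqE negb_and ab.
apply: eq_card => -[c d]; rewrite !inE /= eab set2_eq !xpair_eqE.
apply: andb_idl => /orP[] /andP[/eqP -> /eqP ->]; rewrite /adj; last rewrite setUC.
all: by rewrite -eab.
Qed.

Lemma arcs_in_adj E : simple_graph E -> arcs_in (adj E) setT = 2 * #|E|.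
Proof.
move=> sE; rewrite -card_arcs // (card_pairs (adj E)) /arcs_in (eq_bigl predT) => [|x]; last by rewrite inE.
by apply: eq_bigr => x _; apply: eq_card => y; rewrite !inE.
Qed.

Section Partite.
Variables (r : nat) (p : 'I_n -> 'I_r).

Lemma complete_partiteE a b : ([set a; b] \in complete_partite p) = (p a != p b).
Proof.
rewrite inE; apply/existsP/idP => [[x /existsP[y /andP[pxy]]]|pab]; last first.
  by exists a; apply/existsP; exists b; rewrite pab eqxx.
by rewrite set2_eq => /orP[] /andP[/eqP -> /eqP ->] //; rewrite eq_sym.
Qed.

Lemma complete_partite_simple : simple_graph (complete_partite p).
Proof.
apply/forall_inP => e; rewrite inE => /existsP[x /existsP[y /andP[pxy /eqP ->]]].
have xy : x != y by apply: contraNneq pxy => ->.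
by rewrite cards2 xy.
Qed.

Lemma cross_arcs_card : cross_arcs p = 2 * #|complete_partite p|.
Proof.
rewrite -(card_arcs complete_partite_simple); apply: eq_card => z.
by rewrite !inE [RHS]complete_partiteE.
Qed.

Lemma bad_edge E e : simple_graph E -> e \in E :\: complete_partite p ->
  exists a b, [/\ a != b, e = [set a; b], adj E a b & p a = p b].
Proof.
move=> sE; rewrite inE => /andP[ek eE]; have [a [b [ab eab]]] := simple_pair sE eE.
exists a, b; split=> //; first by rewrite /adj -eab.
by apply/eqP; move: ek; rewrite eab complete_partiteE negbK.
Qed.

End Partite.

Section Copies.
Variables (k : nat) (EF : {set {set 'I_k}}).
Hypothesis sF : simple_graph EF.
Implicit Type f : {ffun 'I_k -> 'I_n}.

Definition homs E : {set {ffun 'I_k -> 'I_n}} :=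
  [set f : {ffun 'I_k -> 'I_n} | injectiveb f && [forall e in EF, (f @: (e : {set 'I_k})) \in E]].

Lemma ncopiesE E : ncopies EF E = #|copy_of EF @: homs E|.
Proof.
by apply: eq_card => cp; apply/imsetP/imsetP => -[f fh ->]; exists f => //; rewrite ?inE in fh *.
Qed.

Lemma homsP E f : reflect (injective f /\ forall e, e \in EF -> f @: (e : {set 'I_k}) \in E) (f \in homs E).
Proof.
rewrite inE; apply: (iffP andP) => [[/injectiveP fi /forall_inP fe]|[fi fe]]; split=> //.
  by apply/injectiveP.
by apply/forall_inP.
Qed.

Lemma imset_pair f i j : f @: [set i; j] = [set f i; f j].
Proof. by rewrite imsetU1 imset_set1. Qed.

End Copies.
End Graph.

Lemma homs_embeddings (n k : nat) (EF : {set {set 'I_k}}) (E : {set {set 'I_n}}) :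
  simple_graph EF -> homs EF E = embeddings (adj EF) (adj E).
Proof.
move=> sF; apply/setP => f; apply/homsP/embeddingsP => -[fi fe]; split=> //.
  by move=> i j /fe; rewrite imset_pair.
by move=> e eF; have [i [j [ij eij]]] := simple_pair sF eF; rewrite eij imset_pair; apply: fe; rewrite /adj -eij.
Qed.

(** All maps with the same copy as image take values in its vertex set, which has at most [k]
    elements. *)
Lemma leq_card_copies (n k : nat) (EF : {set {set 'I_k}}) (A : {set {ffun 'I_k -> 'I_n}}) :
  #|A| <= k ^ k * #|copy_of EF @: A|.
Proof.
apply: card_le_fiber => -[S T].
have [->|[f]] := set_0Vmem [set x in A | copy_of EF x == (S, T)]; first by rewrite cards0.
rewrite inE => /andP[_ /eqP[fS _]].
have Sk : #|S| <= k by rewrite -fS -[X in _ <= X]card_ord -cardsT leq_imset_card.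
apply: (@leq_trans #|(ffun_on (mem S) : pred {ffun 'I_k -> 'I_n})|).
  apply: subset_leq_card; apply/subsetP => f'; rewrite inE => /andP[_ /eqP[fS' _]].
  by apply/ffun_onP => i; rewrite -fS' imset_f.
rewrite card_ffun_on card_ord; have [k0|k0] := posnP k; last by rewrite leq_exp2r.
by rewrite [X in _ ^ X <= _]k0 [X in _ <= _ ^ X]k0 !expn0.
Qed.

(** Distinct values are what edges provide. Any map meeting the prescriptions then forces the
    indices to be distinct; without such a map the count is zero. *)
Lemma card_values (I V : finType) (s : seq (I * V)) : uniq [seq t.2 | t <- s] ->
  #|[set f : {ffun I -> V} | all (fun t => f t.1 == t.2) s]| <= #|V| ^ (#|I| - size s).
Proof.
move=> us; have [->|[f]] := set_0Vmem [set f : {ffun I -> V} | all (fun t => f t.1 == t.2) s].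
  by rewrite cards0.
rewrite inE => /allP fs.
have e : [seq t.2 | t <- s] = [seq f i | i <- [seq t.1 | t <- s]].
  by rewrite -map_comp; apply/eq_in_map => t /fs /eqP.
have {}us : uniq [seq t.1 | t <- s] by rewrite e in us; apply: map_uniq us.
have <- : #|~: [set i in [seq t.1 | t <- s]]| = #|I| - size s.
  by rewrite cardsCs setCK cardsE (card_uniqP us) size_map.
rewrite -(card_prescribed _ f); apply: subset_leq_card; apply/subsetP => f'; rewrite !inE => /allP fs'.
apply/forall_inP => i; rewrite inE => /mapP[t ts ->].
by rewrite (eqP (fs' t ts)) (eqP (fs t ts)).
Qed.

(** * Maps whose image meets a given set of edges *)

Section Hits.
Variables (n k : nat) (B : {set {set 'I_n}}).
Hypothesis sB : simple_graph B.

Definition hitting_maps : {set {ffun 'I_k -> 'I_n}} :=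
  [set f : {ffun 'I_k -> 'I_n} | [exists i, exists j, adj B (f i) (f j)]].

(** An edge of [B] avoiding [v] gives, with [v], three distinct prescribed values, which saves a
    factor [n] over [hitting_maps]. *)
Definition hitting_maps_at (v : 'I_n) : {set {ffun 'I_k -> 'I_n}} :=
  [set f : {ffun 'I_k -> 'I_n} | [exists l, exists i, exists j,
     [&& f l == v, adj B (f i) (f j), v != f i & v != f j]]].

Lemma card_hitting_maps : #|hitting_maps| <= k ^ 2 * (2 * #|B|) * n ^ (k - 2).
Proof.
pose A := setX [set: 'I_k * 'I_k] [set z : 'I_n * 'I_n | adj B z.1 z.2].
have -> : k ^ 2 * (2 * #|B|) = #|A|.
  by rewrite cardsX cardsT card_prod card_ord (card_arcs sB) mulnn.
apply: (@card_union_bound _ _ A (fun t => [set f : {ffun 'I_k -> 'I_n} |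
   all (fun s => f s.1 == s.2) [:: (t.1.1, t.2.1); (t.1.2, t.2.2)]])).
  move=> f; rewrite inE => /existsP[i /existsP[j fij]].
  by exists ((i, j), (f i, f j)); rewrite !inE //= !eqxx.
move=> [[i j] [a b]]; rewrite !inE /= => /(adj_neq sB) ab.
have := @card_values 'I_k 'I_n [:: (i, a); (j, b)]; rewrite !card_ord /= inE ab.
by apply.
Qed.

Lemma card_hitting_maps_at v : #|hitting_maps_at v| <= k ^ 3 * (2 * #|B|) * n ^ (k - 3).
Proof.
pose A := setX [set: 'I_k * 'I_k * 'I_k] [set z : 'I_n * 'I_n | [&& adj B z.1 z.2, v != z.1 & v != z.2]].
apply: (@leq_trans (#|A| * n ^ (k - 3))); last first.
  have k3 : k ^ 3 = k * k * k by rewrite !expnS expn0 muln1 mulnA.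
  rewrite leq_mul2r; apply/orP; right; rewrite cardsX cardsT !card_prod card_ord -(card_arcs sB) k3.
  apply: leq_mul => //; apply: subset_leq_card; apply/subsetP => z.
  by rewrite !inE => /andP[].
apply: (@card_union_bound _ _ A (fun t => [set f : {ffun 'I_k -> 'I_n} |
   all (fun s => f s.1 == s.2) [:: (t.1.1.1, v); (t.1.1.2, t.2.1); (t.1.2, t.2.2)]])).
  move=> f; rewrite inE => /existsP[l /existsP[i /existsP[j /and4P[fl fij vi vj]]]].
  by exists ((l, i, j), (f i, f j)); rewrite !inE /= ?fij ?vi ?vj // fl !eqxx.
move=> [[[l i] j] [a b]]; rewrite !inE /= => /and3P[/(adj_neq sB) ab va vb].
have := @card_values 'I_k 'I_n [:: (l, v); (i, a); (j, b)]; rewrite !card_ord /= !inE ab negb_or va vb.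
by apply.
Qed.

End Hits.

(** * Part sizes and Turan graphs *)

Section Parts.
Variables (n r : nat).
Implicit Types (p q : 'I_n -> 'I_r).

Definition part_size p i := #|[set y | p y == i]|.
Definition balanced p := forall i j, part_size p i <= part_size p j + 1.

Lemma sum_part_size p : \sum_i part_size p i = n.
Proof.
rewrite -[RHS]card_ord -cardsT -(sum_parts p setT); apply: eq_bigr => i _.
by apply: eq_card => y; rewrite !inE.
Qed.

Lemma complete_partite_sqr p :
  2 * #|complete_partite p| + \sum_i part_size p i ^ 2 = n ^ 2.
Proof. by rewrite -cross_arcs_card cross_arcs_parts card_ord. Qed.

(** The sum of the squared part sizes drops: [(b + 1)^2 + c^2 > b^2 + (c + 1)^2] when [b > c]. *)
Lemma move_vertex p v j : part_size p j + 2 <= part_size p (p v) ->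
  #|complete_partite p| < #|complete_partite (fun w => if w == v then j else p w)|.
Proof.
set q := fun w => _ => hj; set i := p v in hj.
have ij : j != i by apply: contraTneq hj => ->; rewrite -ltnNge; lia.
have qi : part_size p i = (part_size q i).+1.
  rewrite /part_size (cardsD1 v) inE eqxx add1n; congr _.+1; apply: eq_card => w.
  by rewrite !inE /q; case: (eqVneq w v) => //= _; rewrite (negbTE ij).
have qj : part_size q j = (part_size p j).+1.
  rewrite /part_size (cardsD1 v) inE /q eqxx eqxx add1n; congr _.+1; apply: eq_card => w.
  by rewrite !inE; case: (eqVneq w v) => [->|] //=; rewrite eq_sym (negbTE ij).
have ql l : l != i -> l != j -> part_size q l = part_size p l.
  move=> li lj; apply: eq_card => w; rewrite !inE /q; case: (eqVneq w v) => [->|//].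
  by rewrite eq_sym (negbTE lj) -/i eq_sym (negbTE li).
have := complete_partite_sqr p; have := complete_partite_sqr q.
have dec (u : 'I_r -> nat) : \sum_l u l = u i + (u j + \sum_(l < r | (l != i) && (l != j)) u l).
  by rewrite (bigD1 i) //= (bigD1 j) //=.
rewrite !dec.
have -> : \sum_(l < r | (l != i) && (l != j)) part_size q l ^ 2 =
          \sum_(l < r | (l != i) && (l != j)) part_size p l ^ 2.
  by apply: eq_bigr => l /andP[li lj]; rewrite ql.
rewrite qj; move: qi hj; set a := part_size p i; set b := part_size q i => ->.
set c := part_size p j; rewrite -!mulnn; nia.
Qed.

(** With [s] the least part size of [p], every integer [t] satisfies [t^2 + s^2 + s >= (2 s + 1) t],
    that is [(t - s) (t - s - 1) >= 0], with equality at [s] and [s + 1], the only part sizes of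
    [p]. Summing over the parts compares the squares. *)
Lemma balanced_max p q : 0 < r -> balanced p -> #|complete_partite q| <= #|complete_partite p|.
Proof.
move=> r0 bp; have [i _ imin] := @arg_minnP _ (Ordinal r0) predT (part_size p) isT.
set s := part_size p i in imin.
have := complete_partite_sqr p; have := complete_partite_sqr q.
have hp : \sum_l part_size p l ^ 2 + r * (s ^ 2 + s) = (2 * s + 1) * n.
  rewrite -[in RHS](sum_part_size p) -[r in X in _ + X](card_ord r) -sum_nat_const -big_split big_distrr /=.
  apply: eq_bigr => l _; have := bp l i; have := imin l isT; rewrite -/s.
  set t := part_size p l => st ts; have [->|->] : t = s \/ t = s + 1 by lia.
    by rewrite -!mulnn; lia.
  by rewrite -!mulnn; lia.
have hq : (2 * s + 1) * n <= \sum_l part_size q l ^ 2 + r * (s ^ 2 + s).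
  rewrite -[X in _ * X <= _](sum_part_size q).
  have -> : r * (s ^ 2 + s) = \sum_(l < r) (s ^ 2 + s) by rewrite sum_nat_const card_ord.
  rewrite -big_split big_distrr /=.
  apply: leq_sum => l _; rewrite -!mulnn; move: (part_size q l) (s) => t u.
  have [tu|tu] := leqP t u.
    have [d ->] : exists d, u = t + d by exists (u - t); lia.
    by nia.
  have [d ->] : exists d, t = u + 1 + d by exists (t - u - 1); lia.
  by nia.
lia.
Qed.

Lemma exists_balanced : 0 < r -> exists p, balanced p.
Proof.
move=> r0; pose F (p : {ffun 'I_n -> 'I_r}) := #|complete_partite p|.
have [p _ pmax] := @arg_maxnP _ [ffun=> Ordinal r0] predT F isT.
exists p => i j; rewrite leqNgt; apply/negP => lt.
have /card_gt0P[v] : 0 < part_size p i by apply: leq_ltn_trans lt.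
rewrite inE => /eqP pv.
have /move_vertex : part_size p j + 2 <= part_size p (p v) by rewrite pv; lia.
have := pmax [ffun w => if w == v then j else p w] isT; rewrite /F => le.
apply/negP; rewrite -leqNgt; apply: leq_trans le; apply: eq_leq.
by apply: eq_card => e; rewrite !inE; apply: eq_existsb => x; apply: eq_existsb => y; rewrite !ffunE.
Qed.

Lemma balanced_part_le p i : balanced p -> r * part_size p i <= n + r.
Proof.
move=> bp; rewrite -[X in X + _](sum_part_size p) -[r in X in _ + X]muln1.
rewrite -[r in X in X <= _](card_ord r) -[r in X in _ + X](card_ord r) -!sum_nat_const -big_split /=.
by apply: leq_sum => j _; apply: bp.
Qed.

(** Supplies the edge hypothesis of [stability], with the same error term [n]. *)
Lemma balanced_card_ge p : 0 < r -> balanced p ->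
  ((1 - r%:R^-1) * n%:R ^+ 2 - n%:R <= (2 * #|complete_partite p|)%N%:R :> rat)%R.
Proof.
move=> r0 bp; have r0' : (0 < r%:R :> rat)%R by rewrite ltr0n.
have le : r * \sum_i part_size p i ^ 2 <= n * (n + r).
  have -> : n * (n + r) = \sum_i part_size p i * (n + r) by rewrite -big_distrl /= sum_part_size.
  rewrite big_distrr /=; apply: leq_sum => i _.
  by rewrite -mulnn mulnA mulnC leq_mul2l balanced_part_le // orbT.
set S := \sum_i _ in le.
have e2 : ((2 * #|complete_partite p|)%N%:R + S%:R = n%:R ^+ 2 :> rat)%R.
  by rewrite -natrD (complete_partite_sqr p) natrX.
have le2 : (S%:R <= r%:R^-1 * (n%:R * (n%:R + r%:R)) :> rat)%R.
  by rewrite ler_pdivlMl // -natrD -!natrM ler_nat.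
have Ru : (r%:R^-1 * r%:R = 1 :> rat)%R by rewrite mulVf // lt0r_neq0.
move: le2 e2.
have -> : (r%:R^-1 * (n%:R * (n%:R + r%:R)) = r%:R^-1 * n%:R ^+ 2 + (r%:R^-1 * r%:R) * n%:R :> rat)%R by ring.
by rewrite Ru; lra.
Qed.

End Parts.

(** * Exchanges *)

Lemma adj_of_edge (n : nat) (E : {set {set 'I_n}}) e a b :
  simple_graph E -> e \in E -> a \in e -> b \in e -> a != b -> adj E a b.
Proof.
move=> sE eE ae be ab; rewrite /adj (_ : [set a; b] = e) //; apply/eqP.
rewrite eqEcard (simple_card sE eE) cards2 ab andbT.
by apply/subsetP => c; rewrite !inE => /orP[] /eqP ->.
Qed.

(** An [r]-colouring of [F - e] gives both ends of [e] one colour, or [F] would be [r]-colourable,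
    and it uses every colour, or [F - e] would be [(r-1)]-colourable. *)
Lemma r_critical_almost_proper (r k : nat) (EF : {set {set 'I_k}}) :
  2 <= r -> simple_graph EF -> r_critical r EF ->
  exists x y (c : 'I_k -> 'I_r), adj EF x y /\ almost_proper (adj EF) x y c.
Proof.
case: r => [|[|r]] // _ sF [[_ [ncol _]] [e eF [[c cP] [ncol' _]]]].
have [x [y [xy ee]]] := simple_pair sF eF.
have cadj i j : adj EF i j -> [set i; j] != e -> c i != c j.
  move=> ij ne; apply: (cP [set i; j]); rewrite ?inE ?eqxx ?orbT ?ne //.
  exact: adj_neq ij.
have cxy : c x = c y.
  apply/eqP/negPn/negP => nxy; apply: ncol; exists c => e' e'F a b ae be ab.
  have adj_ab := adj_of_edge sF e'F ae be ab.
  have [abe|/(cadj _ _ adj_ab)//] := eqVneq [set a; b] e.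
  by move/eqP: abe; rewrite ee set2_eq => /orP[] /andP[/eqP -> /eqP ->] //; rewrite eq_sym.
exists x, y, c; split; first by rewrite /adj -ee.
split=> //.
  move=> a; have [/existsP[i /eqP ci]|] := boolP [exists i, c i == a]; first by exists i.
  rewrite negb_exists => /forallP na.
  case: ncol'; pose c' i := if unlift a (c i) is Some b then b else ord0.
  have lc i : lift a (c' i) = c i.
    by rewrite /c'; case: unliftP => [b ->//|ci]; have := na i; rewrite ci eqxx.
  exists c' => e' e'F u v ue ve uv; have := cP e' e'F u v ue ve uv.
  by apply: contra => /eqP cuv; rewrite -!lc cuv.
move=> i j hij; have [e1|/(cadj _ _ hij) ?] := eqVneq [set i; j] e; last by constructor 1.
by move/eqP: e1; rewrite ee set2_eq => /orP[] /andP[/eqP -> /eqP ->]; [constructor 2|constructor 3].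
Qed.

Lemma not_colorable_card (r k : nat) (EF : {set {set 'I_k}}) : ~ colorable EF r -> r < k.
Proof.
move=> ncol; rewrite ltnNge; apply/negP => kr; apply: ncol.
exists (widen_ord kr) => e _ x y _ _; apply: contra => /eqP xy.
by apply/eqP/val_inj; move/(congr1 val): xy.
Qed.

Section Swap.
Variables (r k : nat) (EF : {set {set 'I_k}}).
Hypotheses (sF : simple_graph EF) (ncol : ~ colorable EF r).
Variable n : nat.
Implicit Types (E B : {set {set 'I_n}}) (p : 'I_n -> 'I_r) (f : {ffun 'I_k -> 'I_n}).

(** Otherwise [p] composed with [f] would be a proper [r]-colouring of [F]. *)
Lemma homs_inner_edge p E f : f \in homs EF E -> exists i j, adj E (f i) (f j) /\ p (f i) = p (f j).
Proof.
case/homsP => fi fE.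
have [/existsP[i /existsP[j /andP[ij /eqP pij]]]|none] :=
  boolP [exists i, exists j, adj EF i j && (p (f i) == p (f j))].
  by exists i, j; split=> //; rewrite /adj -imset_pair; apply: fE.
case: ncol; exists (fun i => p (f i)) => e eF i j ie je ij.
move: none; rewrite negb_exists => /forallP/(_ i); rewrite negb_exists => /forallP/(_ j).
by rewrite (adj_of_edge sF eF ie je ij).
Qed.

Lemma homs_hitting p E B f :
  E \subset complete_partite p :|: B -> f \in homs EF E -> f \in hitting_maps k B.
Proof.
move=> /subsetP EB /(homs_inner_edge p)[i [j [ij pij]]]; rewrite inE.
apply/existsP; exists i; apply/existsP; exists j; move/EB: ij.
by rewrite inE complete_partiteE pij eqxx.
Qed.

Lemma complete_partite_homs p : homs EF (complete_partite p) = set0.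
Proof.
apply/setP => f; rewrite [RHS]inE; apply/negP => /(homs_inner_edge p)[i [j []]].
by rewrite /adj complete_partiteE => /eqP.
Qed.

Lemma complete_partite_free p : Ffree EF (complete_partite p).
Proof. by rewrite /Ffree ncopiesE complete_partite_homs imset0 cards0. Qed.

Lemma complete_partite_le_ex p : #|complete_partite p| <= ex EF n.
Proof.
apply: (@leq_bigmax_cond _ (fun E => simple_graph E && Ffree EF E) (fun E => #|E|)).
by rewrite complete_partite_simple complete_partite_free.
Qed.

Lemma not_homs E f : injective f -> f \notin homs EF E ->
  exists i j, [set f i; f j] \notin E /\ adj EF i j.
Proof.
move=> fi; rewrite inE negb_and (introT (injectiveP f) fi) /= negb_forall => /existsP[e].
rewrite negb_imply => /andP[eF feE]; have [i [j [ij eij]]] := simple_pair sF eF.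
by exists i, j; rewrite -imset_pair /adj -eij.
Qed.

Definition copies_through E (e : {set 'I_n}) :=
  [set cp in copy_of EF @: homs EF E | e \in cp.2].

Lemma homs_image_edge E f (e : {set 'I_n}) :
  f \in homs EF E -> e \in (copy_of EF f).2 -> e \in E.
Proof. by case/homsP => _ fE /imsetP[e' e'F ->]; apply: fE. Qed.

(** A copy in [E'] is either an old one avoiding [e] or the image of a map in [H]. As [E'] has at
    least as many copies as [E], those lost with [e] are made up for by [H]. *)
Lemma copies_through_exchange q E E' e (H : {set {ffun 'I_k -> 'I_n}}) :
  in_HF EF n q E -> simple_graph E' -> #|E'| = #|E| -> e \notin E' ->
  (forall f, f \in homs EF E' -> f \notin homs EF E -> f \in H) ->
  #|copies_through E e| <= #|H|.
Proof.
move=> [_ cE Emin] sE' cE' eE' hH.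
have := Emin E' sE' (etrans cE' cE); rewrite !ncopiesE => le.
rewrite -(leq_add2l #|copy_of EF @: homs EF E :\: copies_through E e|).
have -> : #|copy_of EF @: homs EF E :\: copies_through E e| + #|copies_through E e| =
   #|copy_of EF @: homs EF E|.
  rewrite -(cardsID (copies_through E e) (copy_of EF @: homs EF E)) addnC; congr addn.
  by apply: eq_card => cp; rewrite !inE andbA andbb.
apply: leq_trans le _.
apply: leq_trans (leq_add (leqnn _) (leq_imset_card (copy_of EF) H)).
apply: leq_trans (leq_card_setU _ _); apply: subset_leq_card; apply/subsetP => _ /imsetP[f fE' ->].
rewrite inE; have [fE|fE] := boolP (f \in homs EF E); last first.
  by rewrite [X in _ || X](imset_f (copy_of EF) (hH f fE' fE)) orbT.
rewrite inE [X in _ && X](imset_f (copy_of EF) fE) andbT; apply/orP; left.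
by rewrite inE negb_and; apply/orP; right; apply: contra eE'; apply: homs_image_edge.
Qed.

Lemma exclusive_copies_through p E x y u v :
  adj EF x y ->
  #|exclusive_embeddings (adj EF) x y (adj E) p u v| <= k ^ k * #|copies_through E [set u; v]|.
Proof.
move=> xyF; apply: leq_trans (leq_card_copies EF _) _; rewrite leq_mul2l; apply/orP; right.
apply: subset_leq_card; apply/subsetP => _ /imsetP[f + ->].
rewrite inE => /and4P[fE /eqP fx /eqP fy _].
rewrite inE imset_f ?(homs_embeddings E sF) //=.
by apply/imsetP; exists [set x; y] => //; rewrite imset_pair fx fy.
Qed.

(** [e] is exchanged for the missing pair [xy]. A new copy contains [xy] and an edge of [B]; the
    ends of the latter share a part while [x] and [y] do not, so one of [x], [y] lies off it and is
    a third prescribed vertex. *)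
Lemma missing_edge_exchange q E p x y e :
  in_HF EF n q E -> p x != p y -> ~~ adj E x y -> e \in E :\: complete_partite p ->
  #|copies_through E e| <= 2 * (k ^ 3 * (2 * #|E :\: complete_partite p|) * n ^ (k - 3)).
Proof.
move=> hE pxy xyE eB; set B := E :\: _ in eB *.
have sE : simple_graph E by case: hE.
have sB : simple_graph B by apply: simple_sub sE; apply: subsetDl.
have eE : e \in E by move: eB; rewrite inE => /andP[].
have xyne : [set x; y] != e.
  by apply: contraNneq xyE => xy; rewrite /adj xy.
pose E' := [set x; y] |: (E :\ e).
have xy : x != y by apply: contraNneq pxy => ->.
have sE' : simple_graph E'.
  apply: simpleU; last by apply: simple_sub sE; apply: subsetDl.
  by apply/forall_inP => e'; rewrite inE => /eqP ->; rewrite cards2 xy.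
apply: leq_trans (copies_through_exchange (E' := E') (e := e)
    (H := hitting_maps_at k B x :|: hitting_maps_at k B y) hE sE' _ _ _) _.
- have xyE' : [set x; y] \notin E by [].
  by rewrite /E' cardsU1 in_setD1 (negbTE xyE') andbF (cardsD1 e E) eE.
- by rewrite /E' !inE eqxx orbF eq_sym.
- move=> f fE' /not_homs nf; have /homsP[fi fE'i] := fE'.
  have [l [l' [ll' all']]] := nf fi.
  have : [set f l; f l'] \in E' by rewrite -imset_pair; apply: fE'i.
  rewrite in_setU1 in_setD1 (negbTE ll') andbF orbF set2_eq => fll'.
  have [[a fa] [b fb]] : (exists a, f a = x) /\ (exists b, f b = y).
    by case/orP: fll' => /andP[/eqP fl /eqP fl']; split; [exists l|exists l'|exists l'|exists l].
  have [i [j [ij pij]]] := homs_inner_edge p fE'.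
  have ijB : adj B (f i) (f j).
    move: ij; rewrite /adj in_setU1 in_setD1 set2_eq => /orP[|/andP[_ ijE]].
      by case/orP => /andP[/eqP fi1 /eqP fj1]; move: pxy; rewrite -fi1 -fj1 pij eqxx.
    by rewrite in_setD complete_partiteE pij eqxx ijE.
  have hit z w : f w = z -> z != f i -> z != f j -> f \in hitting_maps_at k B z.
    move=> fw zi zj; rewrite inE; apply/existsP; exists w; apply/existsP; exists i.
    by apply/existsP; exists j; rewrite fw eqxx ijB zi zj.
  rewrite in_setU; have [xi|xi] := eqVneq x (f i).
    have yi : y != f i by rewrite -xi eq_sym.
    have yj : y != f j by apply: contraNneq pxy => yj; rewrite xi yj pij.
    by rewrite (hit y b) ?orbT.
  have [xj|xj] := eqVneq x (f j).
    have yj : y != f j by rewrite -xj eq_sym.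
    have yi : y != f i by apply: contraNneq pxy => yi; rewrite xj yi pij.
    by rewrite (hit y b) ?orbT.
  by rewrite (hit x a).
apply: leq_trans (leq_card_setU _ _) _; rewrite mul2n -addnn.
by apply: leq_add; apply: card_hitting_maps_at.
Qed.

(** Moving [v] gains cross edges, and a set [R] of as many inner edges is given up for them. A new
    copy uses a new edge, which contains [v], and a remaining inner edge, which avoids [v]. *)
Lemma unbalanced_exchange q E p v j :
  in_HF EF n q E -> complete_partite p \subset E ->
  part_size p j + 2 <= part_size p (p v) ->
  (forall e, e \in E :\: complete_partite p -> v \notin e) ->
  (forall p', #|complete_partite (p' : 'I_n -> 'I_r)| <= #|E|) ->
  exists2 e, e \in E :\: complete_partite p &
    #|copies_through E e| <= k ^ 3 * (2 * #|E :\: complete_partite p|) * n ^ (k - 3).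
Proof.
move=> hE KE hj vB Kmax; set B := E :\: _ in vB *.
have sE : simple_graph E by case: hE.
have sB : simple_graph B by apply: simple_sub sE; apply: subsetDl.
pose p' w := if w == v then j else p w.
have lt := move_vertex hj; rewrite -/p' in lt.
have cE : #|E| = #|complete_partite p| + #|B|.
  by rewrite -(cardsID (complete_partite p) E) (setIidPr KE).
(* [Kmax] ensures that there are enough inner edges to pay for the gain. *)
have leB : #|complete_partite p'| - #|complete_partite p| <= #|B| by have := Kmax p'; lia.
have [R RB cR] := exists_subset_card leB.
have [e eR] : exists e, e \in R by apply/card_gt0P; lia.
have B_p' e' : e' \in B -> e' \notin complete_partite p'.
  move=> e'B; have [a [b [ab e'E _ pab]]] := bad_edge sE e'B.
  have := vB e' e'B; rewrite e'E in_set2 negb_or => /andP[va vb].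
  by rewrite complete_partiteE /p' ![_ == v]eq_sym (negbTE va) (negbTE vb) pab eqxx.
have eB : e \in B by apply: (subsetP RB).
exists e => //.
pose E' := complete_partite p' :|: (B :\: R).
have sE' : simple_graph E'.
  by apply: simpleU; [apply: complete_partite_simple | apply: simple_sub sB; apply: subsetDl].
apply: leq_trans (copies_through_exchange (E' := E') (e := e) (H := hitting_maps_at k B v) hE sE' _ _ _) _.
- rewrite /E' cardsU (_ : _ :&: _ = set0) ?cards0; last first.
    apply/setP => e'; rewrite in_setI in_setD in_set0; apply/negP => /and3P[e'K _ e'B].
    by have := B_p' e' e'B; rewrite e'K.
  by rewrite cardsD (setIidPr RB) cE; have := subset_leq_card RB; lia.
- by rewrite /E' inE (negbTE (B_p' e eB)) inE eR.
- move=> f fE' /not_homs nf; have /homsP[fi fE'i] := fE'.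
  have [l [l' [ll' all']]] := nf fi.
  have [a fa] : exists a, f a = v.
    have : [set f l; f l'] \in E' by rewrite -imset_pair; apply: fE'i.
    rewrite inE complete_partiteE => /orP[|]; last first.
      by rewrite in_setD [_ \in B]in_setD (negbTE ll') !andbF.
    have : p (f l) == p (f l').
      apply: contraNT ll' => pll; apply: (subsetP KE); by rewrite complete_partiteE.
    rewrite /p' => /eqP pll.
    have [fl|_] := eqVneq (f l) v; first by exists l.
    have [fl'|_] := eqVneq (f l') v; first by exists l'.
    by rewrite pll eqxx.
  have [i [j' [ij pij]]] := homs_inner_edge p' fE'.
  have ijB : adj B (f i) (f j').
    move: ij; rewrite /adj inE complete_partiteE pij eqxx /=.
    by rewrite in_setD => /andP[].
  have := vB _ ijB; rewrite in_set2 negb_or => /andP[vi vj]; rewrite inE.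
  apply/existsP; exists a; apply/existsP; exists i; apply/existsP; exists j'.
  by rewrite fa eqxx ijB vi vj.
exact: card_hitting_maps_at.
Qed.

End Swap.

(** * Minimizers and the theorem *)

Lemma minover_eq (T : finType) (P : pred T) (F : T -> nat) x :
  P x -> (forall y, P y -> F x <= F y) -> minover P F = F x.
Proof.
move=> Px Fx; apply/eqP; rewrite eqn_leq /minover /=; apply/andP; split; last first.
  apply: (@big_ind _ (fun m => F x <= m)) => [|a b xa xb|y]; last exact: Fx.
    exact: (@leq_bigmax_cond _ P F).
  by rewrite leq_min xa.
set top := \max_(y | _) _; have : x \in index_enum T by rewrite mem_index_enum.
elim: (index_enum T) => // y s IHs; rewrite inE big_cons => /predU1P[<-|xs].
  by rewrite Px geq_minl.
by case: ifP => _; [apply: leq_trans (geq_minr _ _) (IHs xs) | apply: IHs].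
Qed.

Lemma minover_pred0 (T : finType) (P : pred T) (F : T -> nat) : P =1 xpred0 -> minover P F = 0.
Proof. by move=> P0; rewrite /minover !big_pred0. Qed.

(** Translation to edge sets. Having at least as many edges as every complete [r]-partite graph
    yields the density hypothesis, through a balanced partition. *)
Lemma critical_structure_sets (r k : nat) (EF : {set {set 'I_k}}) :
  2 <= r -> simple_graph EF -> r_critical r EF ->
  exists x y (alpha eta : rat), [/\ adj EF x y, (0 < alpha)%R, (0 < eta)%R & exists n0 : nat,
  forall (n : nat) (E : {set {set 'I_n}}), n0 < n -> simple_graph E ->
  (forall p : 'I_n -> 'I_r, #|complete_partite p| <= #|E|) ->
  (#|homs EF E|%:R <= eta * n%:R ^+ k.-1)%R ->
  exists p : 'I_n -> 'I_r, forall u v, adj E u v -> p u = p v ->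
    (alpha * n%:R ^+ (k - 2) <= #|exclusive_embeddings (adj EF) x y (adj E) p u v|%:R)%R].
Proof.
move=> r2 sF hF; have [x [y [c [xyF hc]]]] := r_critical_almost_proper r2 sF hF.
have r0 : 0 < r by apply: ltn_trans r2.
have [alpha [eta [a0 e0 [n0 H]]]] := critical_structure r0 hc.
exists x, y, alpha, eta; split=> //; exists n0 => n E nn sE hK hE.
have := H _ (adj E) (@adj_sym _ E) (adj_irr sE); rewrite !card_ord -(homs_embeddings E sF).
apply=> // [|p]; last by rewrite cross_arcs_card arcs_in_adj // leq_mul2l hK.
have [p bp] := exists_balanced n r0; apply: le_trans (balanced_card_ge r0 bp) _.
by rewrite ler_nat arcs_in_adj // leq_mul2l hK.
Qed.

Section Main.
Variables (r k : nat) (EF : {set {set 'I_k}}).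
Hypotheses (r2 : 2 <= r) (sF : simple_graph EF) (crit : r_critical r EF).

Let ncol : ~ colorable EF r. Proof. by case: crit => [[_ []]]. Qed.

Lemma ex_balanced : exists n0, forall n, n0 < n ->
  forall p : 'I_n -> 'I_r, balanced p -> #|complete_partite p| = ex EF n.
Proof.
have r0 : 0 < r by apply: ltn_trans r2.
have [x [y [alpha [eta [xyF a0 e0 [n0 H]]]]]] := critical_structure_sets r2 sF crit.
exists n0 => n nn p bp; apply/eqP; rewrite eqn_leq (complete_partite_le_ex sF ncol) /=.
have P0 : 0 < #|[pred E : {set {set 'I_n}} | simple_graph E && Ffree EF E]|.
  apply/card_gt0P; exists (complete_partite p).
  by rewrite inE complete_partite_simple (complete_partite_free sF ncol).
have [M /andP[sM fM] exM] := eq_bigmax_cond (fun E : {set {set 'I_n}} => #|E|) P0.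
rewrite /ex exM; have homs0 : homs EF M = set0.
  by apply/eqP; rewrite -(imset_eq0 (copy_of EF)) -cards_eq0 -ncopiesE.
have [||q hq] := H n M nn sM.
- by move=> q; rewrite -exM; apply: complete_partite_le_ex.
- by rewrite homs0 cards0 mulr_ge0 ?exprn_ge0 // ltW.
apply: leq_trans (balanced_max q r0 bp); apply: subset_leq_card.
apply/subsetP => e eM; apply/negPn/negP => eq.
have [u [v [uv eE uvM quv]]] : exists u v, [/\ u != v, e = [set u; v], adj M u v & q u = q v].
  by apply: bad_edge => //; rewrite in_setD eq.
have := hq u v uvM quv; rewrite (_ : exclusive_embeddings _ _ _ _ _ _ _ = set0).
  by rewrite cards0 leNgt mulr_gt0 // exprn_gt0 // ltr0n; apply: leq_ltn_trans nn.
by apply/setP => f; rewrite inE -(homs_embeddings M sF) homs0 !in_set0.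
Qed.

Lemma minimizer_ncopies n q (p : 'I_n -> 'I_r) (E : {set {set 'I_n}}) :
  in_HF EF n q E -> #|complete_partite p| = ex EF n ->
  ncopies EF E <= k ^ 2 * (2 * q) * n ^ (k - 2).
Proof.
move=> [sE cE Emin] cK.
pose all2 := [set e : {set 'I_n} | #|e| == 2].
have leW : q <= #|all2 :\: complete_partite p|.
  (* [E] itself witnesses that there are at least [ex EF n + q] pairs, so [q] pairs can be added. *)
  rewrite cardsD.
  have -> : all2 :&: complete_partite p = complete_partite p.
    apply/setIidPr/subsetP => e eK; rewrite inE; apply/eqP.
    exact: simple_card (complete_partite_simple p) eK.
  have : #|E| <= #|all2| by apply: subset_leq_card; apply/subsetP => e /(simple_card sE); rewrite inE => ->.
  by rewrite cE cK; lia.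
have [W WK cW] := exists_subset_card leW.
have sW : simple_graph W.
  by apply/forall_inP => e /(subsetP WK); rewrite inE => /andP[_]; rewrite inE.
apply: leq_trans (Emin (complete_partite p :|: W) _ _) _.
- by apply: simpleU => //; apply: complete_partite_simple.
- rewrite cardsU (_ : _ :&: _ = set0) ?cards0 ?subn0 ?cK ?cW //.
  apply/setP => e; rewrite in_setI in_set0; apply/negP => /andP[eK /(subsetP WK)].
  by rewrite in_setD eK.
rewrite ncopiesE; apply: leq_trans (leq_imset_card _ _) _.
rewrite -cW; apply: leq_trans (card_hitting_maps k sW); apply: subset_leq_card.
by apply/subsetP => f; apply: (homs_hitting sF ncol (p := p)).
Qed.

Lemma minimizer_structure : exists c1 : rat, (0 < c1)%R /\ exists n0 : nat,
  forall n q : nat, n0 < n -> (q%:R < c1 * n%:R)%R ->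
  forall E : {set {set 'I_n}}, in_HF EF n q E ->
  exists p : 'I_n -> 'I_r, [/\ balanced p, complete_partite p \subset E & #|complete_partite p| = ex EF n].
Proof.
have r0 : 0 < r by apply: ltn_trans r2.
have k3 : 3 <= k by apply: leq_trans (not_colorable_card ncol).
have k1 : k.-1 = (k - 2).+1 by move: k3; clear; lia.
have k2 : k - 2 = (k - 3).+1 by move: k3; clear; lia.
have [x [y [alpha [eta [xyF a0 e0 [n1 Hs]]]]]] := critical_structure_sets r2 sF crit.
have [n2 Hex] := ex_balanced.
(* [C q n^(k-2)] will bound the embeddings into [E]; [D] collects the factors of the larger exchange
   bound. Both include [k^k] maps per copy. *)
pose C := k ^ k * (k ^ 2 * 2); pose D := 4 * (k ^ k * k ^ 3).
have C0 : (0 < C%:R :> rat)%R by rewrite ltr0n !muln_gt0 !expn_gt0; case: (k) k3.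
have D0 : (0 < D%:R :> rat)%R by rewrite ltr0n !muln_gt0 !expn_gt0; case: (k) k3.
have R0 : (0 < r%:R :> rat)%R by rewrite ltr0n.
(* [t <= eta] makes the structure result apply, [D t < alpha^2] makes the exchanges contradictory,
   and [2 r t <= alpha] leaves a vertex of the largest part on no inner edge. *)
have [t [t0 te tD tr]] : exists t : rat, [/\ 0 < t, t <= eta, D%:R * t < alpha ^+ 2 & 2 * r%:R * t <= alpha]%R.
  have a2 : (0 < alpha ^+ 2)%R by rewrite exprn_gt0.
  pose t : rat := Num.min eta (Num.min (alpha ^+ 2 / (2 * D%:R)) (alpha / (2 * r%:R)))%R.
  have D2 : (0 < 2 * D%:R :> rat)%R by apply: mulr_gt0.
  have R2 : (0 < 2 * r%:R :> rat)%R by apply: mulr_gt0.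
  have t1 : (t <= eta)%R by rewrite ge_min lexx.
  have t2 : (t <= alpha ^+ 2 / (2 * D%:R))%R by rewrite !ge_min lexx orbT.
  have t3 : (t <= alpha / (2 * r%:R))%R by rewrite !ge_min lexx !orbT.
  have t0 : (0 < t)%R by rewrite !lt_min e0 !divr_gt0.
  exists t; split=> //; last by rewrite mulrC -ler_pdivlMr.
  by move: t2; rewrite ler_pdivlMr //; move: a2; clear; lra.
exists (t / C%:R)%R; split; first exact: divr_gt0.
exists (maxn n1 n2) => n q; rewrite gtn_max => /andP[nn1 nn2] hq E hE.
have [sE cE Emin] := hE.
have n0 : 0 < n by apply: leq_ltn_trans nn1.
have n0' : (0 < n%:R :> rat)%R by rewrite ltr0n.
have npow m : (0 < n%:R ^+ m :> rat)%R by rewrite exprn_gt0.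
have [p0 bp0] := exists_balanced n r0.
have hK (p : 'I_n -> 'I_r) : #|complete_partite p| <= #|E|.
  by rewrite cE; apply: leq_trans (leq_addr _ _); apply: complete_partite_le_ex.
have Cq : (C%:R * q%:R <= t * n%:R)%R.
  by move: hq; rewrite -mulrA mulrC -mulrA ltr_pdivlMl // [(n%:R * t)%R]mulrC => /ltW.
have hhoms : (#|homs EF E|%:R <= t * n%:R * n%:R ^+ (k - 2))%R.
  apply: (@le_trans _ _ ((C * q * n ^ (k - 2))%N%:R)%R); last first.
    by rewrite natrM natrX [((C * q)%N%:R)%R]natrM ler_pM2r.
  rewrite ler_nat; apply: leq_trans (leq_card_copies EF _) _; rewrite -ncopiesE.
  have := minimizer_ncopies hE (Hex n nn2 p0 bp0); rewrite -(leq_pmul2l (_ : 0 < k ^ k)).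
    by move/leq_trans; apply; rewrite /C; apply: eq_leq; ring.
  by rewrite expn_gt0; case: (k) k3.
have [|p hp] := Hs n E nn1 sE hK.
  apply: (le_trans hhoms); rewrite k1 exprS mulrA.
  by rewrite ler_pM2r // ler_pM2r.
set B := E :\: complete_partite p.
have sB : simple_graph B by apply: simple_sub sE; apply: subsetDl.
have hb : (2 * #|B|%:R * alpha <= t * n%:R)%R.
  rewrite -(ler_pM2r (npow (k - 2))); apply: le_trans hhoms.
  have -> : (2 * #|B|%:R = #|[set z | adj B z.1 z.2]|%:R :> rat)%R by rewrite (card_arcs sB) natrM.
  rewrite (homs_embeddings E sF) -mulrA.
  apply: (exclusive_embeddings_disjoint (x := x) (y := y) (p := p)) => -[u v].
  rewrite inE /= /adj in_setD complete_partiteE negbK => /andP[/eqP puv uvE].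
  exact: hp.
have through e : e \in B ->
    (alpha * n%:R ^+ (k - 2) <= (k ^ k * #|copies_through EF E e|)%N%:R)%R.
  move=> eB; have [u [v [uv -> uvE puv]]] := bad_edge sE eB.
  by apply: le_trans (hp u v uvE puv) _; rewrite ler_nat; apply: exclusive_copies_through.
(* An inner edge lies in at least [alpha n^(k-2) / k^k] copies, which exceeds the exchange bound
   because [hb] makes [#|B|] a small multiple of [n]. *)
have few e : e \in B -> #|copies_through EF E e| <= 2 * (k ^ 3 * (2 * #|B|) * n ^ (k - 3)) -> False.
  move=> eB le; have := through e eB; rewrite k2 exprS.
  have : ((k ^ k * #|copies_through EF E e|)%N%:R <= D%:R * #|B|%:R * n%:R ^+ (k - 3) :> rat)%R.
    rewrite -natrX -!natrM ler_nat; apply: leq_trans (leq_mul (leqnn _) le) _.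
    by rewrite /D; apply: eq_leq; ring.
  move=> le1 /le_trans/(_ le1); rewrite mulrA ler_pM2r // => le2.
  have le3 : (alpha ^+ 2 * n%:R <= D%:R * (#|B|%:R * alpha))%R.
    by rewrite expr2 -mulrA mulrCA mulrA [(alpha * n%:R)%R]mulrC in le2 *; move: (ler_wpM2l (ltW a0) le2); clear; lra.
  have le4 : (D%:R * (2 * #|B|%:R * alpha) <= D%:R * (t * n%:R))%R by rewrite ler_pM2l.
  have le5 : (D%:R * t * n%:R < alpha ^+ 2 * n%:R)%R by rewrite ltr_pM2r.
  have b0 : (0 <= D%:R * (#|B|%:R * alpha))%R by rewrite !mulr_ge0 // ltW.
  by move: le3 le4 le5 b0; clear; lra.
have KE : complete_partite p \subset E.
  apply/negPn/negP => /subsetPn[e eK eE].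
  have [a [b [ab eab]]] := simple_pair (complete_partite_simple p) eK.
  (* Without an inner edge to give up, [E] would be a proper subset of [complete_partite p], against
     [hK]. *)
  have [e' e'B] : exists e', e' \in B.
    apply/set0Pn; apply/negP; rewrite setD_eq0 => EK.
    have : E \proper complete_partite p by apply/properP; split=> //; exists e.
    by move/proper_card; rewrite ltnNge hK.
  apply: (few e' e'B); apply: (missing_edge_exchange sF ncol hE (x := a) (y := b)) => //.
    by rewrite -complete_partiteE -eab.
  by rewrite /adj -eab.
have bp : balanced p.
  move=> i j; rewrite leqNgt; apply/negP => lt.
  (* The vertex to move comes from a largest part, which has more vertices than the inner edges can
     cover. *)
  have [i' _ imax] := @arg_maxnP _ i predT (part_size p) isT.
  have big : 2 * #|B| < part_size p i'.
    have le1 : n <= r * part_size p i'.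
      rewrite -[X in X <= _](sum_part_size p).
      have -> : r * part_size p i' = \sum_(l < r) part_size p i' by rewrite sum_nat_const card_ord.
      by apply: leq_sum => l _; apply: imax.
    rewrite -(ltr_nat rat) natrM -(ltr_pM2r a0); apply: (le_lt_trans hb).
    rewrite -(ltr_pM2l R0).
    have : (2 * r%:R * t * n%:R <= alpha * n%:R)%R by rewrite ler_pM2r.
    have : (alpha * n%:R <= alpha * (r%:R * (part_size p i')%:R))%R.
      by rewrite ler_pM2l // -natrM ler_nat.
    have : (0 < alpha * n%:R)%R by apply: mulr_gt0.
    by clear; lra.
  have cB : #|cover B| <= 2 * #|B|.
    have [le _] := leq_card_cover B; apply: leq_trans le _.
    by rewrite mulnC -sum_nat_const; apply: leq_sum => e eB; rewrite (simple_card sB eB).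
  have lec := leq_cardD [set w | p w == i'] (cover B).
  have /card_gt0P[v] : 0 < #|[set w | p w == i'] :\: cover B|.
    rewrite -(ltn_add2r #|cover B|) add0n; apply: leq_trans lec.
    exact: leq_ltn_trans cB big.
  rewrite in_setD inE => /andP[vB /eqP pv].
  have hj : part_size p j + 2 <= part_size p (p v).
    by rewrite pv; apply: leq_trans (imax i isT); move: lt; clear; lia.
  have vB' e : e \in B -> v \notin e.
    by move=> eB; apply: contra vB => ve; apply/bigcupP; exists e.
  have [e eB le] := unbalanced_exchange sF ncol hE KE hj vB' hK.
  by apply: (few e eB); apply: leq_trans le _; rewrite mul2n -addnn leq_addr.
by exists p; split=> //; apply: Hex.
Qed.

End Main.

Theorem theorem2 (r k : nat) (EF : {set {set 'I_k}}) :
  2 <= r -> simple_graph EF -> r_critical r EF ->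
  exists c1 : rat, (0 < c1)%R /\
  exists n0 : nat, forall n q : nat, n0 < n -> 1 <= q ->
    (q%:R < c1 * n%:R)%R ->
    hF EF n q = tF EF n q /\
    (forall E : {set {set 'I_n}}, in_HF EF n q E -> in_Tqr r n q E).
Proof.
move=> r2 sF crit; have [c1 [c10 [n0 H]]] := minimizer_structure r2 sF crit.
exists c1; split=> //; exists n0 => n q nn _ hq.
have ncol : ~ colorable EF r by case: crit => [[_ []]].
have cD (E : {set {set 'I_n}}) (p : 'I_n -> 'I_r) : in_HF EF n q E ->
    complete_partite p \subset E -> #|complete_partite p| = ex EF n -> #|E :\: complete_partite p| = q.
  by case=> _ cE _ KE cK; rewrite cardsD (setIidPr KE) cE cK addKn.
split; last first.
  move=> E hE; have [p [bp KE cK]] := H n q nn hq E hE; have [sE _ _] := hE.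
  by split=> //; exists (complete_partite p); split; [exists p | split=> //; apply: cD].
have tP (E : {set {set 'I_n}}) : added_to_extremal EF n q E ->
    simple_graph E && (#|E| == ex EF n + q).
  move=> /andP[-> /existsP[M /and5P[ME _ _ /eqP cM /eqP cEM]]] /=.
  by rewrite -(cardsID M E) (setIidPr ME) cM cEM.
(* [minover] over an empty set is [0], so both sides vanish when no graph has that many edges. *)
have [E0 hE0|none] := pickP (fun E : {set {set 'I_n}} => simple_graph E && (#|E| == ex EF n + q)); last first.
  rewrite /hF /tF !minover_pred0 // => E; apply/negP => /tP.
  by rewrite none.
have [E hE Emin] := @arg_minnP _ E0 (fun E => simple_graph E && (#|E| == ex EF n + q)) (@ncopies k n EF) hE0.
have [sE /eqP cE] := andP hE.
have hHF : in_HF EF n q E.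
  by split=> // E' sE' cE'; apply: Emin; rewrite sE' cE' eqxx.
have [p [bp KE cK]] := H n q nn hq E hHF.
transitivity (ncopies EF E); first exact: minover_eq.
(* By [tP] the graphs behind [tF] are among those behind [hF]; the minimizer [E] belongs to both,
   being [complete_partite p] plus [q] edges. *)
apply/esym/minover_eq => [|E' /tP]; last exact: Emin.
rewrite /added_to_extremal sE; apply/existsP; exists (complete_partite p).
by rewrite KE complete_partite_simple (complete_partite_free sF ncol) cK (cD E) ?eqxx.
Qed.
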